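(* Let $\gamma_1,\gamma_2,\gamma_3,\delta_1,\delta_2,\delta_3,x,y\in\mathbb{C}$, let $\alpha_1,\dots,\alpha_4,\beta_1,\dots,\beta_4$ be positive real numbers, and let $\mu_1,\mu_2\in\mathbb{C}$ with $\operatorname{Re}\mu_1>\operatorname{Re}\gamma_2>0$ and $\operatorname{Re}\mu_2>\operatorname{Re}\gamma_3>0$. Then $$D_1\left(\begin{matrix}\gamma_1,\alpha_1,\beta_1;\gamma_2,\alpha_2;\gamma_3,\beta_2;\\ \delta_1,\alpha_3,\beta_3;\delta_2,\alpha_4;\delta_3,\beta_4;\end{matrix}\left|\begin{matrix}x\\ y\end{matrix}\right.\right)=\frac{\Gamma(\mu_1)\Gamma(\mu_2)}{\Gamma(\gamma_2)\Gamma(\gamma_3)\Gamma(\mu_1-\gamma_2)\Gamma(\mu_2-\gamma_3)}\int_0^1\!\!\int_0^1\xi^{\gamma_2-1}\eta^{\gamma_3-1}(1-\xi)^{\mu_1-\gamma_2-1}(1-\eta)^{\mu_2-\gamma_3-1}$$ $$\times D_1\left(\begin{matrix}\gamma_1,\alpha_1,\beta_1;\mu_1,\alpha_2;\mu_2,\beta_2;\\ \delta_1,\alpha_3,\beta_3;\delta_2,\alpha_4;\delta_3,\beta_4;\end{matrix}\left|\begin{matrix}x\xi^{\alpha_2}\\ y\eta^{\beta_2}\end{matrix}\right.\right)d\xi\,d\eta.$$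
   Context: $(\gamma)_\lambda=\Gamma(\gamma+\lambda)/\Gamma(\gamma)$ for $\gamma\in\mathbb{C}$ and real $\lambda\ge0$. For complex $\gamma_i,\delta_i,x,y$ and positive real $\alpha_i,\beta_i$, $$D_1\left(\begin{matrix}\gamma_1,\alpha_1,\beta_1;\gamma_2,\alpha_2;\gamma_3,\beta_2;\\ \delta_1,\alpha_3,\beta_3;\delta_2,\alpha_4;\delta_3,\beta_4;\end{matrix}\left|\begin{matrix}x\\ y\end{matrix}\right.\right)=\sum_{m,n=0}^{\infty}\frac{(\gamma_1)_{\alpha_1 m+\beta_1 n}(\gamma_2)_{\alpha_2 m}(\gamma_3)_{\beta_2 n}}{\Gamma(\delta_1+\alpha_3 m+\beta_3 n)}\frac{x^m}{\Gamma(\delta_2+\alpha_4 m)}\frac{y^n}{\Gamma(\delta_3+\beta_4 n)}.$$ The functions are considered at arguments in the region of absolute convergence of their defining series. *)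

(* Defs.v *)
From HB Require Import structures.
From mathcomp Require Export all_boot all_order all_algebra.
From mathcomp Require Export all_classical all_reals all_analysis.
From mathcomp Require Export complex.

Export Order.TTheory GRing.Theory Num.Theory.
Export numFieldNormedType.Exports.

#[export] Set Implicit Arguments.
#[export] Unset Strict Implicit.
#[export] Unset Printing Implicit Defensive.

Local Open Scope classical_set_scope.
Local Open Scope complex_scope.
Local Open Scope ring_scope.

(* Principal power [t ^ s = exp (s ln t)] of a real [t > 0]; its values at
   [t <= 0] carry no meaning and are never used below. *)
Definition rpowc (R : realType) (t : R) (s : R[i]) : R[i] :=
  (t `^ complex.Re s)%:C *
  (cos (complex.Im s * ln t) +i* sin (complex.Im s * ln t)).

Definition cintegrable d (T : measurableType d) (R : realType)
    (mu : {measure set T -> \bar R}) (D : set T) (f : T -> R[i]) : Prop :=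
  mu.-integrable D (fun t => (complex.Re (f t))%:E) /\
  mu.-integrable D (fun t => (complex.Im (f t))%:E).

Definition cintegral d (T : measurableType d) (R : realType)
    (mu : {measure set T -> \bar R}) (D : set T) (f : T -> R[i]) : R[i] :=
  Rintegral mu D (fun t => complex.Re (f t)) +i*
  Rintegral mu D (fun t => complex.Im (f t)).

(* Euler's integral, meaningful for [0 < Re z]. *)
Definition cGamma_int (R : realType) (z : R[i]) : R[i] :=
  cintegral (@lebesgue_measure R) `]0, +oo[
    (fun t => rpowc t (z - 1) * (expR (- t))%:C).

(* Euler's integral continued to the left half-plane by
   [Gamma z = Gamma (z + n) / (z (z + 1) ... (z + n - 1))], where [n] is chosen
   so that [0 < Re (z + n) <= 1].  At the poles [0, -1, -2, ...] the product
   vanishes, so [cGamma z = 0] there; hence [(cGamma z)^-1] is the entire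
   function [1 / Gamma] everywhere. *)
Definition cGamma (R : realType) (z : R[i]) : R[i] :=
  if 0 < complex.Re z then cGamma_int z else
  let n := (Num.truncn (- complex.Re z)).+1 in
  cGamma_int (z + n%:R) / \prod_(k < n) (z + k%:R).

(* [Gamma (g + l) / Gamma g].  When [g] is a pole of Gamma and [l] is a natural
   number, the quotient is replaced by its limit, the finite product; this gives
   for instance [cpoch g 0 = 1] for every [g].  If [g + l] is a pole and [g] is
   not, the quotient is infinite and [cpoch g l] is a dummy 0. *)
Definition cpoch (R : realType) (g : R[i]) (l : R) : R[i] :=
  if [&& complex.Im g == 0, - complex.Re g \is a Num.nat & l \is a Num.nat]
  then \prod_(k < Num.truncn l) (g + k%:R)
  else cGamma (g + l%:C) / cGamma g.

Definition abs_summable2 (R : realType) (u : nat -> nat -> R[i]) : Prop :=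
  summable [set: nat * nat] (fun p => (ComplexField.Normc.normc (u p.1 p.2))%:E).

(* Limits of the square partial sums of the real and imaginary parts; for an
   absolutely summable family every way of summing gives this value. *)
Definition csum2 (R : realType) (u : nat -> nat -> R[i]) : R[i] :=
  limn (fun N : nat => \sum_(m < N) \sum_(n < N) complex.Re (u m n)) +i*
  limn (fun N : nat => \sum_(m < N) \sum_(n < N) complex.Im (u m n)).

Definition D1_term (R : realType)
    (g1 : R[i]) (a1 b1 : R) (g2 : R[i]) (a2 : R) (g3 : R[i]) (b2 : R)
    (d1 : R[i]) (a3 b3 : R) (d2 : R[i]) (a4 : R) (d3 : R[i]) (b4 : R)
    (x y : R[i]) (m n : nat) : R[i] :=
  (cpoch g1 (a1 * m%:R + b1 * n%:R) * cpoch g2 (a2 * m%:R)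
     * cpoch g3 (b2 * n%:R)) / cGamma (d1 + (a3 * m%:R + b3 * n%:R)%:C)
  * (x ^+ m / cGamma (d2 + (a4 * m%:R)%:C))
  * (y ^+ n / cGamma (d3 + (b4 * n%:R)%:C)).

Definition D1_abs_conv (R : realType)
    (g1 : R[i]) (a1 b1 : R) (g2 : R[i]) (a2 : R) (g3 : R[i]) (b2 : R)
    (d1 : R[i]) (a3 b3 : R) (d2 : R[i]) (a4 : R) (d3 : R[i]) (b4 : R)
    (x y : R[i]) : Prop :=
  abs_summable2 (D1_term g1 a1 b1 g2 a2 g3 b2 d1 a3 b3 d2 a4 d3 b4 x y).

Definition D1 (R : realType)
    (g1 : R[i]) (a1 b1 : R) (g2 : R[i]) (a2 : R) (g3 : R[i]) (b2 : R)
    (d1 : R[i]) (a3 b3 : R) (d2 : R[i]) (a4 : R) (d3 : R[i]) (b4 : R)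
    (x y : R[i]) : R[i] :=
  csum2 (D1_term g1 a1 b1 g2 a2 g3 b2 d1 a3 b3 d2 a4 d3 b4 x y).

(* Main.v *)
Require Import Defs.
From mathcomp Require Import measurable_realfun ring lra.

Local Open Scope classical_set_scope.
Local Open Scope complex_scope.
Local Open Scope ring_scope.

(** Multiplying the Pochhammer factor [(mu)_(a m)] by the Beta integral of
    [u ^ (g + a m - 1) (1 - u) ^ (mu - g - 1)] gives, up to a constant, the factor
    [(g)_(a m)].  So every term of the left series is the integral of the
    corresponding term of the right series against the weight, and the theorem
    says that sum and integral may be exchanged.

    The exchange is [cintegral_csum2]: it needs the sum of the integrals of the
    moduli of the terms to be finite, whereas the hypothesis only controls the
    sum of the moduli of the integrals.  These differ because the parameters are
    complex: the first involves [Gamma (Re g + a m)] where the second has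
    [|Gamma (g + a m)|], and the trivial inequality
    [|Gamma z| <= Gamma (Re z)] goes the wrong way.  The reverse inequality, up to
    a constant along the progression [g + a m], is
    [normc_cGamma_ge_progression].  It comes from concentration
    ([normc_cGamma_ge_large]): under the density [t ^ (T - 1) e ^ (- t)] the
    logarithm of [t] has fluctuations of order [T ^ (- 1 / 2)], so the oscillating
    factor [t ^ (i y)] hardly reduces the integral once [T] is large; this also
    shows, with [Gamma (z + 1) = z Gamma z], that Gamma has no zero in the right
    half-plane ([cGamma_neq0]), which takes care of the finitely many remaining
    [m].  [Rintegral_beta_kernel] packages the resulting comparison.

    The same comparison gives the convergence of the right series inside the
    square, since [xi ^ (a m)] is at most a constant times the Beta integral
    of [u ^ (Re g + a m - 1) (1 - u) ^ (Re mu - Re g - 1)] ([powR_le_beta]).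

    The Beta integral itself is evaluated by [beta_gamma], a computation with
    Fubini's theorem on the plane; the functional equation [cGamma_add1] is
    obtained by differentiating
    [k ^ (- z) Gamma z = int_0^oo t ^ (z - 1) e ^ (- k t) dt] at [k = 1]. *)

(** * Real and imaginary parts, modulus *)

Local Notation normc := (@ComplexField.Normc.normc _).
Local Notation Re := (@complex.Re _).
Local Notation Im := (@complex.Im _).

Section Complex.
Context {R : realType}.
Implicit Types z w : R[i].

Lemma complex_eqP z w : Re z = Re w -> Im z = Im w -> z = w.
Proof. by case: z w => [a b] [c d] /= -> ->. Qed.

Lemma ReD z w : Re (z + w) = Re z + Re w. Proof. by case: z; case: w. Qed.
Lemma ImD z w : Im (z + w) = Im z + Im w. Proof. by case: z; case: w. Qed.
Lemma ReN z : Re (- z) = - Re z. Proof. by case: z. Qed.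
Lemma ImN z : Im (- z) = - Im z. Proof. by case: z. Qed.
Lemma ReM z w : Re (z * w) = Re z * Re w - Im z * Im w.
Proof. by case: z; case: w. Qed.
Lemma ImM z w : Im (z * w) = Re z * Im w + Im z * Re w.
Proof. by case: z; case: w. Qed.

Lemma normc_sqrt z : normc z = Num.sqrt (Re z ^+ 2 + Im z ^+ 2).
Proof. by case: z. Qed.

Lemma normc_ge0 z : 0 <= normc z.
Proof. by rewrite normc_sqrt sqrtr_ge0. Qed.

Lemma normc_real (r : R) : normc r%:C = `|r|.
Proof. by rewrite /= expr0n addr0 sqrtr_sqr. Qed.

Lemma Re_le_normc z : `|Re z| <= normc z.
Proof. by rewrite normc_sqrt -sqrtr_sqr ler_wsqrtr// lerDl sqr_ge0. Qed.

Lemma Im_le_normc z : `|Im z| <= normc z.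
Proof. by rewrite normc_sqrt -sqrtr_sqr ler_wsqrtr// lerDr sqr_ge0. Qed.

Lemma normc_eq0 z : (normc z == 0) = (z == 0).
Proof.
apply/eqP/eqP => [/ComplexField.Normc.eq0_normc//|->].
exact: ComplexField.Normc.normc0.
Qed.

Lemma normc_le z : normc z <= `|Re z| + `|Im z|.
Proof.
rewrite normc_sqrt -[leRHS]ger0_norm ?addr_ge0// -sqrtr_sqr ler_wsqrtr//.
by rewrite sqrrD !real_normK ?num_real// lerD2r lerDl mulrn_wge0// mulr_ge0.
Qed.

End Complex.

(** * Integrals of complex-valued functions *)

Definition crestrict (T : Type) (R : realType) (D : set T) (f : T -> R[i]) :=
  patch (fun=> 0) D f.

Lemma crestrictE (T : Type) (R : realType) (D : set T) (f : T -> R[i]) t :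
  crestrict D f t = if t \in D then f t else 0.
Proof. by []. Qed.

Section CIntegral.
Context d (T : measurableType d) (R : realType).
Variables (mu : {measure set T -> \bar R}) (D : set T).
Hypothesis mD : measurable D.
Implicit Types f g : T -> R[i].

Definition cmeasurable (D : set T) f :=
  measurable_fun D (Re \o f) /\ measurable_fun D (Im \o f).

Lemma cmeasurableM f g :
  cmeasurable D f -> cmeasurable D g -> cmeasurable D (fun t => f t * g t).
Proof.
move=> [rf jf] [rg jg]; split.
- rewrite (_ : _ \o _ = (fun t => (Re \o f) t * (Re \o g) t - (Im \o f) t * (Im \o g) t)).
    by apply: measurable_funB; exact: measurable_funM.
  by apply/funext => t /=; rewrite ReM.
- rewrite (_ : _ \o _ = (fun t => (Re \o f) t * (Im \o g) t + (Im \o f) t * (Re \o g) t)).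
    by apply: measurable_funD; exact: measurable_funM.
  by apply/funext => t /=; rewrite ImM.
Qed.

Lemma cmeasurable_cst z : cmeasurable D (fun=> z).
Proof. by split; exact: measurable_cst. Qed.

Lemma cmeasurable_real (f : T -> R) :
  measurable_fun D f -> cmeasurable D (fun t => (f t)%:C).
Proof. by move=> mf; split => //; exact: measurable_cst. Qed.

Lemma measurable_normc f : cmeasurable D f -> measurable_fun D (normc \o f).
Proof.
move=> [rf jf].
rewrite (_ : _ \o _ = (fun t => Num.sqrt ((Re \o f) t ^+ 2 + (Im \o f) t ^+ 2))).
  apply: (measurableT_comp (continuous_measurable_fun (@sqrt_continuous R))).
  by apply: measurable_funD; exact: measurable_funX.
by apply/funext => t; rewrite /= normc_sqrt.
Qed.

(** The modulus is squeezed between [|Re f|], [|Im f|] and their sum, so this is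
    the criterion through which domination arguments are made. *)
Lemma cintegrableP f :
  cintegrable mu D f <->
  cmeasurable D f /\ mu.-integrable D (EFin \o normc \o f).
Proof.
split=> [[rf jf]|[[rf jf] nf]].
  have cf : cmeasurable D f.
    by split; apply/measurable_EFinP; [exact: measurable_int rf|exact: measurable_int jf].
  split=> //.
  apply: (@le_integrable _ _ _ _ _ _ _ (fun t => `|(Re (f t))%:E| + `|(Im (f t))%:E|)%E) => //.
  - by apply/measurable_EFinP; exact: measurable_normc.
  - move=> t Dt /=; rewrite lee_fin ger0_norm ?normc_ge0//.
    by rewrite ger0_norm ?addr_ge0// normc_le.
  - by apply: integrableD => //; exact: integrable_abse.
split; apply: (le_integrable mD _ _ nf) => //=;
  [exact/measurable_EFinP| |exact/measurable_EFinP|].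
- by move=> t Dt; rewrite lee_fin [leRHS]ger0_norm ?normc_ge0// Re_le_normc.
- by move=> t Dt; rewrite lee_fin [leRHS]ger0_norm ?normc_ge0// Im_le_normc.
Qed.

Lemma cintegrableZ z f :
  cintegrable mu D f -> cintegrable mu D (fun t => z * f t).
Proof.
move=> /cintegrableP[mf nf]; apply/cintegrableP; split.
  by apply: cmeasurableM => //; exact: cmeasurable_cst.
rewrite (_ : _ \o _ = (fun t => (normc z)%:E * (EFin \o normc \o f) t)%E).
  exact: integrableZl.
by apply/funext => t; rewrite /= ComplexField.Normc.normcM EFinM.
Qed.

Lemma cintegralZ z f : cintegrable mu D f ->
  cintegral mu D (fun t => z * f t) = z * cintegral mu D f.
Proof.
move=> [rf jf].
have irf a : mu.-integrable D (EFin \o (fun t => a * Re (f t))).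
  rewrite (_ : _ \o _ = (fun t => a%:E * (Re (f t))%:E)%E); first exact: integrableZl.
  by apply/funext => t /=; rewrite EFinM.
have ijf a : mu.-integrable D (EFin \o (fun t => a * Im (f t))).
  rewrite (_ : _ \o _ = (fun t => a%:E * (Im (f t))%:E)%E); first exact: integrableZl.
  by apply/funext => t /=; rewrite EFinM.
apply: complex_eqP; rewrite ?ReM ?ImM /=.
- under eq_Rintegral do rewrite ReM.
  by rewrite RintegralB// !RintegralZl.
- under eq_Rintegral do rewrite ImM.
  by rewrite RintegralD// !RintegralZl.
Qed.

Lemma cintegral0 : cintegral mu D (fun=> 0) = 0.
Proof. by apply: complex_eqP; rewrite /= Rintegral_cst// mul0r. Qed.

Lemma eq_cintegral f g : {in D, f =1 g} -> cintegral mu D f = cintegral mu D g.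
Proof.
by move=> fg; apply: complex_eqP => /=; apply: eq_Rintegral => t tD; rewrite fg.
Qed.

Lemma eq_cintegrable f g :
  {in D, f =1 g} -> cintegrable mu D f -> cintegrable mu D g.
Proof.
by move=> fg [rf jf]; split; [move: rf|move: jf];
  apply: eq_integrable => // t tD /=; rewrite fg.
Qed.

Lemma Re_crestrict f : Re \o crestrict D f = ((Re \o f) \_ D)%FUN.
Proof. exact: comp_patch. Qed.

Lemma Im_crestrict f : Im \o crestrict D f = ((Im \o f) \_ D)%FUN.
Proof. exact: comp_patch. Qed.

Lemma cmeasurable_restrict f :
  cmeasurable D f -> cmeasurable setT (crestrict D f).
Proof.
by move=> [rf jf]; split; rewrite ?Re_crestrict ?Im_crestrict;
  exact/(measurable_restrictT _ mD).
Qed.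

Lemma cintegral_restrict f : cintegral mu D f = cintegral mu setT (crestrict D f).
Proof.
apply: complex_eqP.
- by rewrite /= -[X in _ = Rintegral _ _ X]/(Re \o crestrict D f)
    Re_crestrict -Rintegral_mkcond.
- by rewrite /= -[X in _ = Rintegral _ _ X]/(Im \o crestrict D f)
    Im_crestrict -Rintegral_mkcond.
Qed.

Lemma cintegrable_restrict f :
  cintegrable mu D f <-> cintegrable mu setT (crestrict D f).
Proof.
rewrite /cintegrable.
rewrite -[X in _ <-> mu.-integrable _ X /\ _]/(EFin \o (Re \o crestrict D f)).
rewrite -[X in _ <-> _ /\ mu.-integrable _ X]/(EFin \o (Im \o crestrict D f)).
rewrite Re_crestrict Im_crestrict -!restrict_EFin.
by split=> -[h1 h2]; split;
  [exact/(integrable_mkcond _ mD).1|exact/(integrable_mkcond _ mD).1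
  |exact/(integrable_mkcond _ mD).2|exact/(integrable_mkcond _ mD).2].
Qed.

End CIntegral.

Lemma cmeasurable_comp d d' (T : measurableType d) (T' : measurableType d')
    (R : realType) (f : T' -> R[i]) (g : T -> T') :
  cmeasurable setT f -> measurable_fun setT g -> cmeasurable setT (f \o g).
Proof.
by move=> [rf jf] mg; split; [exact: measurableT_comp rf mg|exact: measurableT_comp jf mg].
Qed.

(** * Product measures *)

Section CFubini.
Context d1 d2 (T1 : measurableType d1) (T2 : measurableType d2) (R : realType).
Variables (m1 : {sigma_finite_measure set T1 -> \bar R})
  (m2 : {sigma_finite_measure set T2 -> \bar R}).

(** The inner integral is finite only for almost every [x]; elsewhere the real
    inner integral is a default value, on a null set. *)
Lemma Rfubini1 (f : T1 * T2 -> R) :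
  (m1 \x m2)%E.-integrable setT (EFin \o f) ->
  Rintegral m1 setT (fun x => Rintegral m2 setT (fun y => f (x, y))) =
  Rintegral (m1 \x m2)%E setT f.
Proof.
move=> intf; rewrite [RHS]/Rintegral -integral12_prod_meas1//.
congr fine; have iF := integrable_fubini_F intf.
apply: ae_eq_integral => //.
- apply/measurable_EFinP; apply: (measurableT_comp (fine_measurable measurableT)) => //.
  exact: measurable_int iF.
- exact: measurable_int iF.
- have := integrable_ae measurableT iF; apply: filterS => x h _.
  by rewrite /Rintegral fineK//; exact: h.
Qed.

Lemma Rfubini2 (f : T1 * T2 -> R) :
  (m1 \x m2)%E.-integrable setT (EFin \o f) ->
  Rintegral m2 setT (fun y => Rintegral m1 setT (fun x => f (x, y))) =
  Rintegral (m1 \x m2)%E setT f.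
Proof.
move=> intf; rewrite [RHS]/Rintegral -integral21_prod_meas1//.
congr fine; have mG := measurable_fubini_G intf.
apply: ae_eq_integral => //.
- by apply/measurable_EFinP; apply: (measurableT_comp (fine_measurable measurableT)).
- have := ae_integrable2 intf; apply: filterS => y h _.
  by rewrite /Rintegral fineK//; exact: integrable_fin_num.
Qed.

Lemma cfubini1 (f : T1 * T2 -> R[i]) : cintegrable (m1 \x m2)%E setT f ->
  cintegral m1 setT (fun x => cintegral m2 setT (fun y => f (x, y))) =
  cintegral (m1 \x m2)%E setT f.
Proof.
move=> [rf jf]; apply: complex_eqP => /=.
- exact: (Rfubini1 (f := Re \o f)).
- exact: (Rfubini1 (f := Im \o f)).
Qed.

Lemma cfubini2 (f : T1 * T2 -> R[i]) : cintegrable (m1 \x m2)%E setT f ->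
  cintegral m2 setT (fun y => cintegral m1 setT (fun x => f (x, y))) =
  cintegral (m1 \x m2)%E setT f.
Proof.
move=> [rf jf]; apply: complex_eqP => /=.
- exact: (Rfubini2 (f := Re \o f)).
- exact: (Rfubini2 (f := Im \o f)).
Qed.

End CFubini.

Section Product.
Context d1 d2 (T1 : measurableType d1) (T2 : measurableType d2) (R : realType).
Variables (m1 : {sigma_finite_measure set T1 -> \bar R})
  (m2 : {sigma_finite_measure set T2 -> \bar R}).

Lemma cintegrable_tonelli (f : T1 * T2 -> R[i]) :
  cmeasurable setT f ->
  (\int[m1]_x \int[m2]_y (normc (f (x, y)))%:E < +oo)%E ->
  cintegrable (m1 \x m2)%E setT f.
Proof.
move=> mf flty; apply/cintegrableP => //; split=> //.
apply/integrable12ltyP; first by apply/measurable_EFinP; exact: measurable_normc.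
rewrite (_ : (fun _ => _) = (fun x => \int[m2]_y (normc (f (x, y)))%:E)%E)//.
apply/funext => x; apply: eq_integral => y _ /=.
by rewrite ger0_norm ?normc_ge0.
Qed.

Lemma tonelli_prod (f : T1 -> R) (g : T2 -> R) :
  measurable_fun setT f -> measurable_fun setT g ->
  (forall x, 0 <= f x) -> (forall y, 0 <= g y) ->
  (\int[m1]_x \int[m2]_y (f x * g y)%:E =
   (\int[m1]_x (f x)%:E) * (\int[m2]_y (g y)%:E))%E.
Proof.
move=> mf mg f0 g0.
transitivity (\int[m1]_x ((\int[m2]_y (g y)%:E) * (f x)%:E))%E.
  apply: eq_integral => x _.
  under eq_integral do rewrite EFinM.
  rewrite ge0_integralZl//; [by rewrite muleC|exact/measurable_EFinP|..].
  - by move=> y _; rewrite lee_fin.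
  - by rewrite lee_fin.
rewrite ge0_integralZl//; [by rewrite muleC|exact/measurable_EFinP|..].
- by move=> x _; rewrite lee_fin.
- by apply: integral_ge0 => y _; rewrite lee_fin.
Qed.

Lemma cintegrable_prod (f : T1 -> R[i]) (g : T2 -> R[i]) :
  cintegrable m1 setT f -> cintegrable m2 setT g ->
  cintegrable (m1 \x m2)%E setT (fun p => f p.1 * g p.2).
Proof.
move=> /cintegrableP-/(_ measurableT)[mf nf] /cintegrableP-/(_ measurableT)[mg ng].
apply: cintegrable_tonelli.
  apply: cmeasurableM.
    exact: (cmeasurable_comp mf measurable_fst).
  exact: (cmeasurable_comp mg measurable_snd).
under eq_integral do under eq_integral do rewrite /= ComplexField.Normc.normcM.
rewrite tonelli_prod//; try exact: measurable_normc; try by move=> ?; exact: normc_ge0.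
by rewrite -ge0_fin_numE ?mule_ge0 ?integral_ge0// => [|x _|x _];
  rewrite ?lee_fin ?normc_ge0// fin_numM//; exact: integrable_fin_num.
Qed.

Lemma cintegral_prod (f : T1 -> R[i]) (g : T2 -> R[i]) :
  cintegrable m1 setT f -> cintegrable m2 setT g ->
  cintegral (m1 \x m2)%E setT (fun p => f p.1 * g p.2) =
  cintegral m1 setT f * cintegral m2 setT g.
Proof.
move=> jf jg; rewrite -cfubini1; last exact: cintegrable_prod.
rewrite mulrC -cintegralZ//; apply: eq_cintegral => x _.
by rewrite (cintegralZ measurableT (f x) jg) mulrC.
Qed.

End Product.

Lemma Rintegral_prod d1 d2 (T1 : measurableType d1) (T2 : measurableType d2)
    (R : realType) (m1 : {sigma_finite_measure set T1 -> \bar R})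
    (m2 : {sigma_finite_measure set T2 -> \bar R}) (f : T1 -> R) (g : T2 -> R) :
  m1.-integrable setT (EFin \o f) -> m2.-integrable setT (EFin \o g) ->
  (forall x, 0 <= f x) -> (forall y, 0 <= g y) ->
  Rintegral (m1 \x m2)%E setT (fun p => f p.1 * g p.2) =
  Rintegral m1 setT f * Rintegral m2 setT g.
Proof.
move=> fi gi f0 g0.
have mf : measurable_fun setT f by apply/measurable_EFinP; exact: measurable_int fi.
have mg : measurable_fun setT g by apply/measurable_EFinP; exact: measurable_int gi.
rewrite /Rintegral -fineM; [|exact: integrable_fin_num..].
rewrite -(tonelli_prod m1 m2 mf mg f0 g0); congr fine.
rewrite (fubini_tonelli1 (fun p : T1 * T2 => (f p.1 * g p.2)%:E))//.
- apply/measurable_EFinP; apply: measurable_funM.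
    exact: (measurableT_comp mf measurable_fst).
  exact: (measurableT_comp mg measurable_snd).
- by move=> p; rewrite lee_fin mulr_ge0.
Qed.

(** * Double series and termwise integration *)

Section SquareSums.
Context {R : realType}.
Implicit Types (h w : nat -> nat -> R) (u : nat -> nat -> R[i]).

Definition square_sum (V : nmodType) (h : nat -> nat -> V) (N : nat) : V :=
  \sum_(m < N) \sum_(n < N) h m n.

Lemma square_sumD h w N :
  square_sum (fun m n => h m n + w m n) N = square_sum h N + square_sum w N.
Proof.
by rewrite /square_sum -big_split; apply: eq_bigr => m _; rewrite -big_split.
Qed.

Lemma square_sumZ c h N :
  square_sum (fun m n => c * h m n) N = c * square_sum h N.
Proof.
by rewrite /square_sum big_distrr; apply: eq_bigr => m _; rewrite big_distrr.
Qed.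

Lemma le_square_sum h w N : (forall m n, h m n <= w m n) ->
  square_sum h N <= square_sum w N.
Proof. by move=> hw; apply: ler_sum => m _; apply: ler_sum => n _. Qed.

Lemma square_sum_nd h : (forall m n, 0 <= h m n) ->
  nondecreasing_seq (square_sum h).
Proof.
move=> h0; apply/nondecreasing_seqP => N; rewrite /square_sum big_ord_recr /=.
rewrite ler_wpDr ?sumr_ge0//; apply: ler_sum => m _.
by rewrite big_ord_recr lerDl.
Qed.

(** Both [h] and [h + w] are nonnegative with bounded, hence convergent, square
    sums; [w] is their difference. *)
Lemma square_sum_cvg h w (B : R) : (forall m n, `|w m n| <= h m n) ->
  (forall N, square_sum h N <= B) -> cvgn (square_sum w).
Proof.
move=> wh hB.
have h0 m n : 0 <= h m n by exact: le_trans (wh m n).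
have ch : cvgn (square_sum h).
  apply: nondecreasing_is_cvgn; first exact: square_sum_nd.
  by exists B => _ [N _ <-].
have cd : cvgn (square_sum (fun m n => h m n + w m n)).
  apply: nondecreasing_is_cvgn.
    apply: square_sum_nd => m n.
    by rewrite -lerBlDl sub0r; have := wh m n; rewrite ler_norml => /andP[].
  exists (B + B) => _ [N _ <-]; rewrite square_sumD lerD//.
  apply: le_trans (hB N); apply: le_square_sum => m n.
  by rewrite (le_trans (ler_norm _)).
rewrite (_ : square_sum w =
  square_sum (fun m n => h m n + w m n) \- square_sum h); first exact: is_cvgB.
by apply/funext => N; rewrite /= square_sumD addrAC subrr add0r.
Qed.

(** Every finite set of indices lies in a square, so for nonnegative families
    unordered summability is boundedness of the square sums. *)
Lemma abs_summable2P u :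
  abs_summable2 u <->
  exists B : R, forall N, square_sum (fun m n => normc (u m n)) N <= B.
Proof.
rewrite /abs_summable2 /summable.
under eq_esum do rewrite gee0_abs ?lee_fin ?normc_ge0//.
set a := fun p : nat * nat => (normc (u p.1 p.2))%:E.
have a0 p : (0 <= a p)%E by rewrite lee_fin normc_ge0.
have sqE N : (square_sum (fun m n => normc (u m n)) N)%:E =
    (\sum_(p \in `I_N `*` `I_N) a p)%E.
  rewrite -(pair_fsbig _ (fun m n => (normc (u m n))%:E))//=.
  rewrite -fsbig_ord -sumEFin; apply: eq_bigr => m _.
  by rewrite -fsbig_ord -sumEFin.
have fin N : finite_set (`I_N `*` `I_N : set (nat * nat)) by exact: finite_setX.
split=> [alty|[B aB]].
- have e0 : (0 <= \esum_(p in setT) a p)%E by exact: esum_ge0.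
  exists (fine (\esum_(p in setT) a p)) => N.
  rewrite -lee_fin fineK ?ge0_fin_numE// sqE.
  by apply: esum_ge; exists (`I_N `*` `I_N).
- apply: (@le_lt_trans _ _ B%:E); last by rewrite ltry.
  apply: ge_ereal_sup => /= _ [X [finX _]] <-.
  have [N XN] : exists N, X `<=` `I_N `*` `I_N.
    have [F XF] := finite_fsetP.1 finX.
    exists (\max_(p <- finmap.enum_fset F) (maxn p.1 p.2)).+1 => p; rewrite XF /= => pF.
    have : (maxn p.1 p.2 <= \max_(p <- finmap.enum_fset F) (maxn p.1 p.2))%N.
      by apply: leq_bigmax_seq.
    by rewrite geq_max => /andP[? ?]; split; rewrite ltnS.
  apply: (@le_trans _ _ (\sum_(p \in `I_N `*` `I_N) a p)%E).
    by apply: lee_fsum_nneg_subset => // p; rewrite !inE; exact: XN.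
  by rewrite -sqE lee_fin.
Qed.

Lemma csum2E u :
  csum2 u = limn (square_sum (fun m n => Re (u m n))) +i*
            limn (square_sum (fun m n => Im (u m n))).
Proof. by []. Qed.

Lemma csum2_cvg u : abs_summable2 u ->
  cvgn (square_sum (fun m n => Re (u m n))) /\
  cvgn (square_sum (fun m n => Im (u m n))).
Proof.
by move=> /abs_summable2P[B uB]; split; apply: square_sum_cvg uB => m n;
  [exact: Re_le_normc|exact: Im_le_normc].
Qed.

Lemma csum2Z (z : R[i]) u : abs_summable2 u ->
  csum2 (fun m n => z * u m n) = z * csum2 u.
Proof.
move=> /csum2_cvg[cr ci].
have cZ (c : R) w : cvgn (square_sum w) ->
    limn (square_sum (fun m n => c * w m n)) = c * limn (square_sum w) /\
    cvgn (square_sum (fun m n => c * w m n)).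
  move=> cw; have h : square_sum (fun m n => c * w m n) @ \oo -->
      c * limn (square_sum w).
    rewrite (_ : square_sum _ = (fun N => c * square_sum w N)).
      by apply: cvgM => //; exact: cvg_cst.
    by apply/funext => N; exact: square_sumZ.
  by split; [exact/cvg_lim|exact: cvgP h].
rewrite csum2E; apply: complex_eqP; rewrite ?ReM ?ImM /=.
- rewrite (_ : square_sum _ = square_sum (fun m n => Re z * Re (u m n)) \+
     square_sum (fun m n => (- Im z) * Im (u m n))).
    have [e1 c1] := cZ (Re z) _ cr; have [e2 c2] := cZ (- Im z) _ ci.
    by rewrite limD// e1 e2 mulNr.
  apply/funext => N; rewrite /= -square_sumD; congr square_sum.
  by apply/funext => m; apply/funext => n; rewrite ReM mulNr.
- rewrite (_ : square_sum _ = square_sum (fun m n => Re z * Im (u m n)) \+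
     square_sum (fun m n => Im z * Re (u m n))).
    have [e1 c1] := cZ (Re z) _ ci; have [e2 c2] := cZ (Im z) _ cr.
    by rewrite limD// e1 e2.
  apply/funext => N; rewrite /= -square_sumD; congr square_sum.
  by apply/funext => m; apply/funext => n; rewrite ImM.
Qed.

Lemma abs_summable2Z (z : R[i]) (u : nat -> nat -> R[i]) :
  abs_summable2 u -> abs_summable2 (fun m n => z * u m n).
Proof.
move=> /abs_summable2P[B uB]; apply/abs_summable2P; exists (normc z * B) => N.
rewrite (_ : square_sum _ N = normc z * square_sum (fun m n => normc (u m n)) N).
  by rewrite ler_wpM2l ?normc_ge0.
rewrite -square_sumZ; congr square_sum.
by apply/funext => m; apply/funext => n; rewrite ComplexField.Normc.normcM.
Qed.

Lemma abs_summable2_0 : abs_summable2 (fun _ _ => 0 : R[i]).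
Proof.
apply/abs_summable2P; exists 0 => N; rewrite /square_sum.
by rewrite big1// => i _; rewrite big1// => j _; exact: ComplexField.Normc.normc0.
Qed.

Lemma csum2_0 : csum2 (fun _ _ => 0 : R[i]) = 0.
Proof.
transitivity (csum2 (fun _ _ => 0 * 0 : R[i])).
  by congr csum2; apply/funext => i; apply/funext => j; rewrite mul0r.
by rewrite csum2Z ?mul0r//; exact: abs_summable2_0.
Qed.

End SquareSums.

Section Termwise.
Context d (T : measurableType d) (R : realType).
Variables (mu : {measure set T -> \bar R}) (D : set T).
Hypothesis mD : measurable D.

Lemma square_sum_integrable (w : nat -> nat -> T -> R) N :
  (forall m n, mu.-integrable D (EFin \o w m n)) ->
  mu.-integrable D (EFin \o (fun t => square_sum (fun m n => w m n t) N)) /\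
  Rintegral mu D (fun t => square_sum (fun m n => w m n t) N) =
  square_sum (fun m n => Rintegral mu D (w m n)) N.
Proof.
move=> iw.
have sum1 M (g : nat -> T -> R) : (forall m, mu.-integrable D (EFin \o g m)) ->
    mu.-integrable D (EFin \o (fun t => \sum_(m < M) g m t)) /\
    Rintegral mu D (fun t => \sum_(m < M) g m t) =
    \sum_(m < M) Rintegral mu D (g m).
  move=> ig; elim: M => [|M [IH1 IH2]].
    rewrite big_ord0; split.
      rewrite (_ : _ \o _ = cst 0%E); first exact: integrable0.
      by apply/funext => t /=; rewrite big_ord0.
    under eq_Rintegral do rewrite big_ord0.
    by rewrite /Rintegral integral0.
  rewrite big_ord_recr -IH2; split.
    rewrite (_ : _ \o _ = (fun t => (\sum_(m < M) g m t)%:E + (g M t)%:E)%E).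
      exact: (integrableD mD IH1 (ig M)).
    by apply/funext => t /=; rewrite big_ord_recr.
  under eq_Rintegral do rewrite big_ord_recr.
  by rewrite RintegralD.
have h m := sum1 N (w m) (iw m).
have [h1 h2] := sum1 N (fun m t => \sum_(n < N) w m n t) (fun m => (h m).1).
split; first exact: h1.
by rewrite /square_sum h2; apply: eq_bigr => m _; have [] := h m.
Qed.

(** Dominated convergence: the limit of the square partial sums of [h] is an
    integrable majorant of the partial sums of [w]. *)
Lemma Rintegral_square_sum (w h : nat -> nat -> T -> R) (B : R) :
  (forall m n, measurable_fun D (w m n)) ->
  (forall m n, mu.-integrable D (EFin \o h m n)) ->
  (forall m n t, D t -> `|w m n t| <= h m n t) ->
  (forall N, square_sum (fun m n => Rintegral mu D (h m n)) N <= B) ->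
  (forall t, D t -> exists C : R, forall N, square_sum (fun m n => h m n t) N <= C) ->
  let S t := limn (square_sum (fun m n => w m n t)) in
  mu.-integrable D (EFin \o S) /\
  Rintegral mu D S = limn (square_sum (fun m n => Rintegral mu D (w m n))).
Proof.
move=> mw ih wh hB hp S.
have h0 m n t : D t -> 0 <= h m n t by move=> /(wh m n); exact: le_trans.
have iw m n : mu.-integrable D (EFin \o w m n).
  apply: (le_integrable mD _ _ (ih m n)); first exact/measurable_EFinP.
  by move=> t Dt /=; rewrite lee_fin [leRHS]ger0_norm ?h0//; exact: wh.
pose H N t := square_sum (fun m n => h m n t) N.
(* by monotone convergence the integral of [G] is at most [B] *)
pose G t := limn (fun N => (H N t)%:E).
have iH N := square_sum_integrable N ih.
have mH N : measurable_fun D (EFin \o H N) by have [/measurable_int] := iH N.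
have ndH t : D t -> nondecreasing_seq (fun N => H N t).
  by move=> Dt; apply: square_sum_nd => m n; exact: h0.
have HG N t : D t -> ((H N t)%:E <= G t)%E.
  move=> Dt; apply: lime_ge.
    by apply: ereal_nondecreasing_is_cvgn => M M' MM'; rewrite lee_fin ndH.
  by exists N => // M /= NM; rewrite lee_fin ndH.
have H0 N t : D t -> 0 <= H N t.
  by move=> Dt; apply: sumr_ge0 => m _; apply: sumr_ge0 => n _; exact: h0.
have iG : mu.-integrable D G.
  apply/integrableP; split.
    apply: (emeasurable_fun_cvg (fun N => EFin \o H N)) => // t Dt.
    by apply: ereal_nondecreasing_is_cvgn => M M' MM'; rewrite lee_fin ndH.
  under eq_integral => t /[!inE] Dt.
    rewrite gee0_abs; last by rewrite (le_trans _ (HG 0%N t Dt))// lee_fin H0.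
    over.
  have H0e N t : D t -> (0 <= (EFin \o H N) t)%E.
    by move=> Dt; rewrite lee_fin H0.
  have ndHe t : D t -> nondecreasing_seq (fun N => (EFin \o H N) t).
    by move=> Dt M M' MM'; rewrite lee_fin ndH.
  rewrite (monotone_convergence mu mD mH H0e ndHe).
  apply: (@le_lt_trans _ _ B%:E); last by rewrite ltry.
  apply: lime_le.
    apply: ereal_nondecreasing_is_cvgn => M M' MM'; apply: ge0_le_integral => //.
    + by move=> t Dt; rewrite lee_fin H0.
    + by move=> t Dt; rewrite lee_fin ndH.
  apply: nearW => N; have [i1 i2] := iH N.
  by rewrite -[leLHS]fineK ?integrable_fin_num// lee_fin -[X in X <= _]/(Rintegral _ _ _) i2.
pose W N t := square_sum (fun m n => w m n t) N.
have iW N := square_sum_integrable N iw.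
have mW N : measurable_fun D (EFin \o W N) by have [/measurable_int] := iW N.
have cW t : D t -> W ^~ t @ \oo --> S t.
  by move=> Dt; have [C hC] := hp t Dt; apply: square_sum_cvg hC => m n; exact: wh.
have [iS _ cS] : [/\ mu.-integrable D (EFin \o S),
    (\int[mu]_(t in D) `|(W N t)%:E - (S t)%:E|)%E @[N --> \oo] --> 0%E &
    (\int[mu]_(t in D) (W N t)%:E)%E @[N --> \oo] --> (\int[mu]_(t in D) (S t)%:E)%E].
  apply: (@dominated_convergence _ _ _ mu D mD (fun N => EFin \o W N) (EFin \o S) G) => //.
  - by apply/measurable_EFinP; apply: (measurable_fun_cvg (h := W)) => // N; exact/measurable_EFinP.
  - by apply: aeW => t Dt; apply: cvg_EFin; [exact: nearW|exact: cW].
  - apply: aeW => t N Dt /=; apply: le_trans (HG N t Dt); rewrite lee_fin.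
    apply: le_trans (ler_norm_sum _ _ _) _; apply: ler_sum => m _.
    by apply: le_trans (ler_norm_sum _ _ _) _; apply: ler_sum => n _; exact: wh.
split=> //; apply/esym/cvg_lim => //.
rewrite -[X in X @ _](_ : (fine \o
    (fun N => \int[mu]_(t in D) (W N t)%:E)%E) = _); last first.
  by apply/funext => N; have [_ <-] := iW N.
by apply: fine_cvg; rewrite /Rintegral fineK ?integrable_fin_num.
Qed.

(** The real and imaginary parts of [v m n] are both dominated by its modulus. *)
Lemma cintegral_csum2 (v : nat -> nat -> T -> R[i]) (B : R) :
  (forall m n, cintegrable mu D (v m n)) ->
  (forall N, square_sum (fun m n => Rintegral mu D (normc \o v m n)) N <= B) ->
  (forall t, D t -> abs_summable2 (fun m n => v m n t)) ->
  cintegrable mu D (fun t => csum2 (fun m n => v m n t)) /\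
  cintegral mu D (fun t => csum2 (fun m n => v m n t)) =
  csum2 (fun m n => cintegral mu D (v m n)).
Proof.
move=> iv vB vp.
have h1 m n := (cintegrableP mu mD (v m n)).1 (iv m n).
have mr m n : measurable_fun D (Re \o v m n) by have [[]] := h1 m n.
have mi m n : measurable_fun D (Im \o v m n) by have [[]] := h1 m n.
have ih m n : mu.-integrable D (EFin \o (normc \o v m n)) by have [] := h1 m n.
have hp t : D t -> exists C : R, forall N,
    square_sum (fun m n => (normc \o v m n) t) N <= C.
  by move=> /vp/abs_summable2P.
have [ir er] := Rintegral_square_sum mr ih (fun m n t _ => Re_le_normc _) vB hp.
have [ii ei] := Rintegral_square_sum mi ih (fun m n t _ => Im_le_normc _) vB hp.
by split; [split|apply: complex_eqP].
Qed.

End Termwise.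

(** * Affine change of variable *)

Section Affine.
Context {R : realType}.
Local Notation mu := (@lebesgue_measure R).
Variables a b : R.
Hypothesis a_gt0 : 0 < a.

Let phi : measurableTypeR R -> measurableTypeR R := fun x => a * x + b.

Lemma measurable_affine : measurable_fun [set: measurableTypeR R] phi.
Proof.
by apply: measurable_funD => //; exact: measurable_funM.
Qed.

(** Lebesgue measure is determined by its values on half-open intervals, where
    the formula is a computation of lengths. *)
Lemma lebesgue_measure_affine (A : set (measurableTypeR R)) : measurable A ->
  pushforward mu phi A = (a^-1%:E * mu A)%E.
Proof.
pose push : {measure set (measurableTypeR R) -> \bar R} := pushforward mu phi.
pose nu : {measure set (measurableTypeR R) -> \bar R} :=
  mscale (NngNum (ltW a_gt0)) (push measurable_affine).
move=> mA; rewrite (@lebesgue_measure_unique R nu)//.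
  by rewrite /= /mscale /= muleA -EFinM mulVf ?gt_eqF// mul1e.
move=> _ [[l r] /= lr <-]; rewrite /nu /= /mscale /= /pushforward.
rewrite (_ : phi @^-1` _ = `](l - b) / a, (r - b) / a]%classic); last first.
  apply/seteqP; split=> x; rewrite /phi /= !in_itv /=;
    by rewrite ltr_pdivrMr// ler_pdivlMr// ltrBlDr lerBrDr mulrC.
rewrite !lebesgue_measure_itv /= !lte_fin ltr_pM2r ?invr_gt0// ltrD2r.
case: ifPn => _; rewrite ?mule0// -EFinB -EFinM; congr EFin.
by field; rewrite gt_eqF.
Qed.

Lemma ge0_integral_affine (f : measurableTypeR R -> \bar R) :
  measurable_fun setT f -> (forall x, 0 <= f x)%E ->
  (\int[mu]_x f (a * x + b)%R = a^-1%:E * \int[mu]_x f x)%E.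
Proof.
move=> mf f0; have ai0 : 0 <= a^-1 by rewrite invr_ge0 ltW.
transitivity (\int[pushforward mu phi]_x f x)%E.
  rewrite ge0_integral_pushforward//; exact: measurable_affine.
rewrite -(ge0_integral_mscale mu measurableT (NngNum ai0))//.
apply: eq_measure_integral => [|? A mA _]; first exact: measurable_affine.
exact: lebesgue_measure_affine.
Qed.

Lemma integrable_affine (f : measurableTypeR R -> \bar R) :
  mu.-integrable setT f -> mu.-integrable setT (fun x => f (a * x + b)).
Proof.
move=> /integrableP[mf fi]; apply/integrableP; split.
  exact: (measurableT_comp mf measurable_affine).
rewrite (ge0_integral_affine (f := fun x => `|f x|)%E)//.
  rewrite -ge0_fin_numE ?mule_ge0 ?integral_ge0 ?lee_fin ?invr_ge0 ?ltW//.
  by rewrite fin_numM// ge0_fin_numE// integral_ge0.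
exact: measurableT_comp.
Qed.

Lemma Rintegral_affine (f : measurableTypeR R -> R) :
  mu.-integrable setT (EFin \o f) ->
  Rintegral mu setT (fun x => f (a * x + b)) = a^-1 * Rintegral mu setT f.
Proof.
move=> fi; have mf := measurable_int _ fi.
rewrite -RintegralZl// /Rintegral; congr fine.
under [RHS]eq_integral do rewrite EFinM.
rewrite (integralZl measurableT fi).
rewrite [X in _ = (_ * X)%E]integralE [LHS]integralE.
pose fe := EFin \o f; pose g x := fe (a * x + b).
have gp : (g^\+ = (fun x => fe^\+ (a * x + b)%R))%E by exact: funepos_comp.
have gn : (g^\- = (fun x => fe^\- (a * x + b)%R))%E by exact: funeneg_comp.
rewrite -/fe -/g gp gn.
rewrite (ge0_integral_affine (measurable_funepos mf))//.
rewrite (ge0_integral_affine (measurable_funeneg mf))//.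
(* unnamed, these integrals would unfold to differences that [muleBr] matches *)
set P := integral _ _ _; set Q := integral _ _ _.
have PQ : (P +? - Q)%E.
  apply: fin_num_adde_defl; rewrite fin_numN.
  by apply: integrable_fin_num => //; exact: integrable_funeneg.
by rewrite (muleBr _ PQ).
Qed.

Lemma cintegrable_affine (f : measurableTypeR R -> R[i]) :
  cintegrable mu setT f -> cintegrable mu setT (fun x => f (a * x + b)).
Proof.
by move=> [rf jf]; split; [exact: integrable_affine rf|exact: integrable_affine jf].
Qed.

Lemma cintegral_affine (f : measurableTypeR R -> R[i]) :
  cintegrable mu setT f ->
  cintegral mu setT (fun x => f (a * x + b)) = a^-1%:C * cintegral mu setT f.
Proof.
move=> [rf jf]; apply: complex_eqP; rewrite ?ReM ?ImM /= mul0r ?subr0 ?addr0.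
- exact: (Rintegral_affine (f := Re \o f)).
- exact: (Rintegral_affine (f := Im \o f)).
Qed.

End Affine.

(** * Complex powers of positive reals *)

Section Power.
Context {R : realType}.
Implicit Types (t a : R) (s z : R[i]).

Lemma normc_rpowc t z : normc (rpowc t z) = t `^ Re z.
Proof.
rewrite /rpowc ComplexField.Normc.normcM normc_real ger0_norm ?powR_ge0//.
by rewrite [X in _ * X]/= cos2Dsin2 sqrtr1 mulr1.
Qed.

Lemma rpowc_real t (r : R) : rpowc t r%:C = (t `^ r)%:C.
Proof. by rewrite /rpowc /= mul0r cos0 sin0 mulr1. Qed.

Lemma rpowcD t s z : 0 < t -> rpowc t (s + z) = rpowc t s * rpowc t z.
Proof.
move=> t0; rewrite /rpowc ReD ImD powRD ?(gt_eqF t0) ?implybT// mulrDl cosD sinD.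
apply: complex_eqP; rewrite !(ReM, ImM) /=; ring.
Qed.

Lemma rpowcM a t z : 0 < a -> 0 < t -> rpowc (a * t) z = rpowc a z * rpowc t z.
Proof.
move=> a0 t0; rewrite /rpowc powRM ?ltW// lnM ?posrE// mulrDr cosD sinD.
apply: complex_eqP; rewrite !(ReM, ImM) /=; ring.
Qed.

Lemma rpowc0 t : rpowc t 0 = 1.
Proof. by rewrite -[0]/(0%:C) rpowc_real powRr0. Qed.

Lemma rpowc1 t : 0 < t -> rpowc t 1 = t%:C.
Proof. by move=> t0; rewrite -[1]/(1%:C) rpowc_real powRr1// ltW. Qed.

Lemma cmeasurable_rpowc z : cmeasurable setT (fun t => rpowc t z).
Proof.
have mln : measurable_fun [set: R] (fun t => Im z * ln t).
  by apply: measurable_funM => //; exact: measurable_ln.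
apply: cmeasurableM; first by apply: cmeasurable_real; exact: measurable_powR.
split.
- exact: (measurableT_comp (continuous_measurable_fun (@continuous_cos R)) mln).
- exact: (measurableT_comp (continuous_measurable_fun (@continuous_sin R)) mln).
Qed.

(** The density [t ^ (z - 1)] of the Mellin transform, extended by zero to the
    whole line so that translations and dilations act on it. *)
Definition mellin z t : R[i] := if 0 < t then rpowc t (z - 1) else 0.

Definition mellinr (x t : R) : R := if 0 < t then t `^ (x - 1) else 0.

Lemma mellinr_ge0 x t : 0 <= mellinr x t.
Proof. by rewrite /mellinr; case: ifP => // _; exact: powR_ge0. Qed.

Lemma normc_mellin z t : normc (mellin z t) = mellinr (Re z) t.
Proof.
rewrite /mellin /mellinr; case: ifP => _; last exact: ComplexField.Normc.normc0.
by rewrite normc_rpowc ReD ReN.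
Qed.

Lemma mellin_real (x : R) t : mellin x%:C t = (mellinr x t)%:C.
Proof.
rewrite /mellin /mellinr; case: ifP => _ //.
by rewrite -rpowc_real rmorphB.
Qed.

Lemma mellinM a z t : 0 < a -> mellin z (a * t) = rpowc a (z - 1) * mellin z t.
Proof.
move=> a0; rewrite /mellin pmulr_rgt0//; case: ifP => [t0|_].
  by rewrite rpowcM.
by rewrite mulr0.
Qed.

Lemma mellinD z s t : 0 < t -> mellin (z + s) t = rpowc t s * mellin z t.
Proof. by move=> t0; rewrite /mellin t0 -rpowcD//; congr rpowc; ring. Qed.

Lemma cmeasurable_mellin z : cmeasurable setT (mellin z).
Proof.
rewrite (_ : mellin z = crestrict `]0, +oo[ (fun t => rpowc t (z - 1))).
  apply: cmeasurable_restrict => //.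
  have [h1 h2] := cmeasurable_rpowc (z - 1).
  by split; exact: measurable_funTS.
apply/funext => t; rewrite crestrictE /mellin.
by congr (if _ then _ else _); apply/idP/idP; rewrite ?inE /= in_itv /= andbT.
Qed.

Lemma measurable_mellinr (x : R) : measurable_fun setT (mellinr x).
Proof.
have [h _] := cmeasurable_mellin x%:C.
rewrite (_ : mellinr x = Re \o mellin x%:C)//.
by apply/funext => t /=; rewrite mellin_real.
Qed.

End Power.

(** * The Gamma integral *)

Section GammaIntegrable.
Context {R : realType}.
Local Notation mu := (@lebesgue_measure R).

(** The suffixes c and r distinguish the complex densities from their moduli,
    which are the densities with real parameters. *)
Definition gammac (z : R[i]) (t : R) : R[i] := mellin z t * (expR (- t))%:C.
Definition gammar (x t : R) : R := mellinr x t * expR (- t).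

Lemma gammar_ge0 x t : 0 <= gammar x t.
Proof. by rewrite mulr_ge0 ?mellinr_ge0 ?expR_ge0. Qed.

Lemma normc_gammac z t : normc (gammac z t) = gammar (Re z) t.
Proof.
rewrite /gammac ComplexField.Normc.normcM normc_mellin normc_real.
by rewrite ger0_norm ?expR_ge0.
Qed.

Lemma gammac_real x t : gammac x%:C t = (gammar x t)%:C.
Proof. by rewrite /gammac mellin_real -rmorphM. Qed.

Lemma measurable_expN : measurable_fun [set: R] (fun t : R => expR (- t)).
Proof. by apply: measurableT_comp => //; exact: measurable_expR. Qed.

Lemma cmeasurable_gammac z : cmeasurable setT (gammac z).
Proof.
apply: cmeasurableM; first exact: cmeasurable_mellin.
by apply: cmeasurable_real; exact: measurable_expN.
Qed.

Lemma measurable_gammar x : measurable_fun setT (gammar x).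
Proof.
by apply: measurable_funM; [exact: measurable_mellinr|exact: measurable_expN].
Qed.

(** The primitive [t ^ x / x] on [1 / (n + 2), 1], then [n] to infinity. *)
Lemma integral_powR_le (x : R) : 0 < x ->
  (\int[mu]_(t in `]0%R, 1%R]) (t `^ (x - 1))%:E <= (x^-1)%:E)%E.
Proof.
move=> x0; pose F (n : nat) : set (measurableTypeR R) := `[n.+2%:R^-1 : R, 1]%classic.
have n01 n : 0 < (n.+2%:R^-1 : R) < 1.
  by apply/andP; split; [rewrite invr_gt0 ltr0n|rewrite invf_lt1 ?ltr0n ?ltr1n].
have FE : \bigcup_n F n = `]0, 1]%classic.
  apply/seteqP; split=> t.
    move=> [n _]; rewrite /F /= !in_itv /= => /andP[h ->]; rewrite andbT.
    by apply: lt_le_trans h; have /andP[] := n01 n.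
  rewrite /= in_itv /= => /andP[t0 t1]; exists (Num.truncn t^-1) => //.
  rewrite /F /= in_itv /= t1 andbT invf_ple ?posrE ?ltr0n//.
  apply: le_trans (ltW (truncnS_gt _)) _.
  by rewrite ler_nat.
have ndF : nondecreasing_seq F.
  move=> m n mn; apply/subsetPset/subset_itvr; rewrite bnd_simp.
  by rewrite lef_pV2 ?posrE ?ltr0n// ler_nat.
have mp (D : set (measurableTypeR R)) : measurable_fun D (fun t : R => (t `^ (x - 1))%:E).
  by apply/measurable_EFinP; apply: measurable_funTS; exact: measurable_powR.
rewrite -FE.
have cI : (\int[mu]_(t in F i) (t `^ (x - 1))%:E @[i --> \oo] -->
    \int[mu]_(t in \bigcup_i F i) (t `^ (x - 1))%:E)%E.
  apply: ge0_nondecreasing_set_cvg_integral => //.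
  - by move=> n; exact: measurable_itv.
  - by move=> n t _; rewrite lee_fin powR_ge0.
rewrite -(cvg_lim _ cI)//; apply: lime_le; first exact: cvgP cI.
apply: nearW => n; have /andP[n0 n1] := n01 n.
have pos (t : R) : t \in `[n.+2%:R^-1, 1] -> 0 < t.
  by rewrite in_itv /= => /andP[h _]; exact: lt_le_trans h.
pose G (t : R) := x^-1 * t `^ x.
have dG (t : R) : 0 < t -> is_derive t 1 G (t `^ (x - 1)).
  move=> t0; have := is_derive1_powR x t0 => d.
  by apply: is_derive_eq; rewrite /GRing.scale /= mulrA mulVf ?gt_eqF// mul1r.
have cG (t : R) : 0 < t -> {for t, continuous G}.
  move=> t0; apply/differentiable_continuous/derivable1_diffP.
  by have [] := dG _ t0.
rewrite (@continuous_FTC2 _ _ G)//.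
- by rewrite /G powR1 mulr1 -EFinB lee_fin gerBl mulr_ge0 ?powR_ge0// invr_ge0 ltW.
- apply: continuous_in_subspaceT => t /[!inE]/pos t0.
  apply/differentiable_continuous/derivable1_diffP.
  by have [] := is_derive1_powR (x - 1) t0.
- split.
  + move=> t /subset_itv_oo_cc/pos t0; have [] := dG _ t0; exact.
  + apply: cvg_at_right_filter; exact: cG.
  + apply: cvg_at_left_filter; exact: cG.
- move=> t /subset_itv_oo_cc/pos t0; rewrite derive1E.
  by have [_ ->] := dG _ t0.
Qed.

(** A single term of the exponential series already beats the power. *)
Lemma powR_expR_bound (x : R) : exists K : R, 0 <= K /\
  forall t : R, 1 <= t -> t `^ x <= K * expR (t / 2).
Proof.
pose n := (Num.truncn x).+1; pose K : R := 2 ^+ n * (n`!)%:R.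
exists K; split; first by rewrite mulr_ge0 ?exprn_ge0.
move=> t t1; have t0 : 0 <= t by exact: le_trans t1.
apply: (@le_trans _ _ (t ^+ n)).
  by rewrite -powR_mulrn// ler_powR// ltW// truncnS_gt.
have := @expR_ge1Dxn R (t / 2) n.-1 (divr_ge0 t0 (ler0n _ 2)).
rewrite /K exprMn exprVn prednK// => h.
have {}h : t ^+ n / 2 ^+ n / (n`!)%:R <= expR (t / 2).
  by apply: le_trans h; rewrite lerDr.
have n0 : 0 < (n`!)%:R :> R by rewrite ltr0n fact_gt0.
by move: h; rewrite ler_pdivrMr// ler_pdivrMr ?exprn_gt0// mulrC [X in _ * X]mulrC mulrA.
Qed.

(** Dominated by [t ^ (x - 1)] on [0, 1] and, beyond, by a multiple of the
    exponential density of rate [1 / 2]. *)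
Lemma integrable_gammar (x : R) : 0 < x -> mu.-integrable setT (EFin \o gammar x).
Proof.
move=> x0; have [K [K0 hK]] := powR_expR_bound (x - 1).
pose h := ((fun t : measurableTypeR R => (t `^ (x - 1))%:E) \_ `]0%R, 1%R])%E.
pose k := (fun t : measurableTypeR R => (K * 2)%:E * (exponential_pdf (2^-1 : R) t)%:E)%E.
have mp : measurable_fun (`]0, 1]%classic : set (measurableTypeR R)) (fun t : R => (t `^ (x - 1))%:E).
  by apply/measurable_EFinP; apply: measurable_funTS; exact: measurable_powR.
have ih : mu.-integrable setT h.
  apply/(integrable_mkcond _ _).1 => //; apply/integrableP; split => //.
  apply: (@le_lt_trans _ _ (x^-1)%:E); last by rewrite ltry.
  apply: le_trans (integral_powR_le x0).
  under eq_integral do rewrite gee0_abs ?lee_fin ?powR_ge0//.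
  by [].
have ik : mu.-integrable setT k.
  by apply: integrableZl => //; apply: integrable_exponential_pdf; lra.
apply: (le_integrable measurableT _ _ (integrableD measurableT ih ik)).
- by apply/measurable_EFinP; exact: measurable_gammar.
- move=> t _; rewrite /= ger0_norm ?gammar_ge0//.
  have h0 u : (0 <= h u)%E by apply: erestrict_ge0 => v _; rewrite lee_fin powR_ge0.
  have k0 u : (0 <= k u)%E.
    rewrite mule_ge0 ?lee_fin ?exponential_pdf_ge0 ?mulr_ge0//; lra.
  rewrite gee0_abs ?adde_ge0// /gammar /mellinr.
  case: ifPn => [t0|_]; last by rewrite mul0r adde_ge0.
  have [t1|t1] := leP t 1.
    apply: le_trans (leeDl _ (k0 _)); rewrite /h patchE mem_set; last first.
      by rewrite /= in_itv /= t0 t1.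
    rewrite lee_fin ler_piMr ?powR_ge0// -[leRHS]expR0 ler_expR; lra.
  apply: le_trans (leeDr _ (h0 _)); rewrite /k.
  have -> : exponential_pdf (2^-1 : R) t = 2^-1 * expR (- 2^-1 * t).
    by rewrite exponential_pdfE ?(ltW t0).
  rewrite -EFinM lee_fin.
  rewrite (_ : K * 2 * _ = K * expR (t / 2) * expR (- t)); last first.
    rewrite mulrA -[K * 2 * 2^-1]mulrA divff// mulr1 -mulrA -expRD.
    by congr (_ * expR _); lra.
  by rewrite ler_pM2r ?expR_gt0// hK// ltW.
Qed.

Lemma cintegrable_gammac z : 0 < Re z -> cintegrable mu setT (gammac z).
Proof.
move=> z0; apply/cintegrableP => //; split; first exact: cmeasurable_gammac.
rewrite (_ : _ \o _ = EFin \o gammar (Re z)); first exact: integrable_gammar.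
by apply/funext => t; rewrite /= normc_gammac.
Qed.

Lemma cGammaE z : 0 < Re z -> cGamma z = cintegral mu setT (gammac z).
Proof.
move=> z0; rewrite /cGamma z0 /cGamma_int cintegral_restrict.
congr cintegral; apply/funext => t; rewrite crestrictE /gammac /mellin.
have -> : (t \in `]0, +oo[%classic) = (0 < t).
  by apply/idP/idP; rewrite inE /= in_itv /= andbT.
by case: ifP => // _; rewrite mul0r.
Qed.

Definition rGamma (x : R) : R := Rintegral mu setT (gammar x).

Lemma cGamma_real x : 0 < x -> cGamma x%:C = (rGamma x)%:C.
Proof.
move=> x0; rewrite cGammaE//; apply: complex_eqP => /=.
- by apply: eq_Rintegral => t _; rewrite gammac_real.
- under eq_Rintegral do rewrite gammac_real.
  by rewrite Rintegral_cst// mul0r.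
Qed.

End GammaIntegrable.

(** * Positivity and the triangle inequality *)

Section Positivity.
Context {R : realType}.
Local Notation mu := (@lebesgue_measure R).

Lemma ae_exists (P : R -> Prop) (l r : R) :
  l < r -> {ae mu, forall x, P x} -> exists x, l < x < r /\ P x.
Proof.
move=> lr [N [mN N0 PN]]; apply: contrapT => h.
have lrN : `]l, r[%classic `<=` N.
  move=> x; rewrite /= in_itv /= => xlr; apply: PN => /= Px; apply: h.
  by exists x.
have : (mu `]l, r[%classic <= mu N)%E by apply: le_measure; rewrite ?inE.
rewrite N0 lebesgue_measure_itv /= lte_fin lr -EFinB lee_fin.
by rewrite leNgt subr_gt0 lr.
Qed.

Lemma Rintegral_gt0 (f : R -> R) (l r : R) : l < r ->
  mu.-integrable setT (EFin \o f) -> (forall x, 0 <= f x) ->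
  (forall x, l < x < r -> 0 < f x) -> 0 < Rintegral mu setT f.
Proof.
move=> lr fi f0 fp; rewrite lt0r Rintegral_ge0// andbT.
apply/eqP => I0.
have : (\int[mu]_(x in setT) `|(EFin \o f) x| = 0)%E.
  under eq_integral do rewrite /= ger0_norm//.
  by rewrite -[LHS]fineK ?integrable_fin_num// -[fine _]/(Rintegral _ _ _) I0.
move=> /(ae_eq_integral_abs mu measurableT (measurable_int _ fi)) ae0.
have [x [xlr h]] := ae_exists lr ae0.
have /eqP := h I; rewrite eqe; apply/negP; exact: lt0r_neq0 (fp x xlr).
Qed.

(** With [z] the integral, [|z| ^ 2] is the real part of the integral of
    [conj z * f], which is at most [|z|] times the integral of [|f|]. *)
Lemma normc_cintegral d (T : measurableType d) (m : {measure set T -> \bar R})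
    (f : T -> R[i]) : cintegrable m setT f ->
  normc (cintegral m setT f) <= Rintegral m setT (normc \o f).
Proof.
move=> fi; have := fun w => cintegralZ measurableT w fi.
move: (cintegral m setT f) => z wz.
have [->|z0] := eqVneq z 0.
  by rewrite ComplexField.Normc.normc0 Rintegral_ge0// => t _; exact: normc_ge0.
have nz : 0 < normc z by rewrite lt0r normc_ge0 andbT normc_eq0.
have ni : m.-integrable setT (EFin \o (normc \o f)).
  by have [] := (cintegrableP m measurableT f).1 fi.
rewrite -(ler_pM2l nz) -RintegralZl//.
have -> : normc z * normc z = Re (conjc z * z).
  rewrite -expr2 normc_sqrt sqr_sqrtr ?addr_ge0 ?sqr_ge0// ReM.
  by case: (z) => a b /=; ring.
rewrite -wz -[Re _]/(Rintegral m setT (fun t => Re (conjc z * f t))).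
have ci := cintegrableZ measurableT (conjc z) fi.
apply: le_Rintegral => //; first exact: ci.1.
  rewrite (_ : _ \o _ = (fun t => (normc z)%:E * (EFin \o (normc \o f)) t)%E).
    exact: integrableZl.
  by apply/funext => t; rewrite /= EFinM.
move=> t _; apply: le_trans (ler_norm _) _; apply: le_trans (Re_le_normc _) _.
rewrite ComplexField.Normc.normcM [X in X * _](_ : _ = normc z)//.
by case: (z) => a b /=; rewrite sqrrN.
Qed.

End Positivity.

(** * Functional equation of Gamma *)

Section GammaFunctional.
Context {R : realType}.
Local Notation mu := (@lebesgue_measure R).
Implicit Types (z : R[i]) (x y : R).

(** [\int_0^oo t^(z-1) e^(-k t) dt = k^(-z) Gamma z]. *)
Lemma cintegral_mellin_exp (k : R) z : 0 < k -> 0 < Re z ->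
  cintegrable mu setT (fun t => mellin z t * (expR (- (k * t)))%:C) /\
  cintegral mu setT (fun t => mellin z t * (expR (- (k * t)))%:C) =
  rpowc k (- z) * cGamma z.
Proof.
move=> k0 z0.
have E : (fun t => mellin z t * (expR (- (k * t)))%:C) =
    (fun t => rpowc k (1 - z) * gammac z (k * t + 0)).
  apply/funext => t; rewrite addr0 /gammac mellinM// mulrA [in RHS]mulrA -rpowcD//.
  by rewrite (_ : 1 - z + (z - 1) = 0) ?rpowc0 ?mul1r//; ring.
have gi := cintegrable_affine 0 k0 (cintegrable_gammac z0).
rewrite E; split; first exact: cintegrableZ.
rewrite cintegralZ// cintegral_affine//; last exact: cintegrable_gammac.
rewrite -cGammaE// mulrA; congr (_ * _).
rewrite (_ : 1 - z = - z + 1); last by ring.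
rewrite rpowcD// rpowc1// -mulrA -rmorphM /= divff ?gt_eqF//.
by rewrite mulr1.
Qed.

(** Differentiation under the integral sign: for [a > 1 / 2] the derivative is
    dominated by [t ^ x e ^ (- t / 2)]. *)
Lemma derive_laplace (w : R -> R) x : 0 < x ->
  measurable_fun setT w -> (forall t, `|w t| <= mellinr x t) ->
  is_derive (1 : R) 1
    (fun a : R => Rintegral mu setT (fun t => w t * expR (- (a * t))))
    (- Rintegral mu setT (fun t => t * w t * expR (- t))).
Proof.
move=> x0 mw wx.
pose f (a t : R) := w t * expR (- (a * t)).
pose G (t : R) := mellinr (x + 1) t * expR (- (2^-1 * t)).
have expm (a : R) : measurable_fun setT (fun t : R => expR (- (a * t))).
  apply: measurableT_comp; first exact: measurable_expR.
  by apply: measurableT_comp => //; exact: measurable_funM.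
have iexp (k u : R) : 0 < k -> 0 < u ->
    mu.-integrable setT (EFin \o (fun t => mellinr u t * expR (- (k * t)))).
  move=> k0 u0; have [[h _] _] := cintegral_mellin_exp (z := u%:C) k0 u0.
  apply: eq_integrable h => // t _; rewrite /= mellin_real.
  by rewrite ReM /= mul0r subr0.
have w0 t : t <= 0 -> w t = 0.
  by move=> t0; have := wx t; rewrite /mellinr ltNge t0 /= normr_le0 => /eqP.
have df (a t : R) : is_derive a 1 (f ^~ t) (- (t * w t * expR (- (a * t)))).
  rewrite /f; apply: is_derive_eq.
  by rewrite /GRing.scale /= ; ring.
have d1 (a t : R) : partial1of2 f a t = - (t * w t * expR (- (a * t))).
  by rewrite partial1of2E; have [_ ->] := df a t.
have I1 : `]2^-1, 2[%classic (1 : R) by rewrite /= in_itv /= invf_lt1 ?ltr1n.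
have intf (a : R) : `]2^-1, 2[%classic a -> mu.-integrable setT (EFin \o f a).
  rewrite /= in_itv /= => /andP[a2 _].
  have a0 : 0 < a by lra.
  apply: (le_integrable measurableT _ _ (iexp a x a0 x0)).
    by apply/measurable_EFinP; exact: (measurable_funM mw (expm a)).
  move=> t _; rewrite /= lee_fin /f !normrM ler_wpM2r//.
  by rewrite [leRHS]ger0_norm ?mellinr_ge0.
have der (a t : R) : `]2^-1, 2[%classic a -> setT t -> derivable (f ^~ t) a 1.
  by move=> _ _; have [] := df a t.
have G0 t : 0 <= G t by rewrite mulr_ge0 ?mellinr_ge0 ?expR_ge0.
have iG : mu.-integrable setT (EFin \o G) by apply: iexp; rewrite ?invr_gt0 ?ltr0n ?addr_gt0.
have Gub (a t : R) : `]2^-1, 2[%classic a -> setT t -> `|partial1of2 f a t| <= G t.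
  rewrite /= in_itv /= => /andP[a2 _] _.
  rewrite d1 normrN !normrM [X in _ * X]ger0_norm ?expR_ge0//.
  have [t0|t0] := leP t 0; first by rewrite w0// normr0 mulr0 mul0r.
  rewrite /G; apply: ler_pM; rewrite ?mulr_ge0//.
    have -> : mellinr (x + 1) t = t * mellinr x t.
      by rewrite /mellinr t0 mulr_powRB1 ?ltW//; congr (_ `^ _); ring.
    by rewrite ger0_norm ?(ltW t0)// ler_wpM2l// ltW.
  by rewrite ler_expR lerN2 ler_pM2r// ltW.
have h1 := derivable_under_integral measurableT I1 intf der G0 iG Gub.
have h2 := differentiation_under_integral measurableT I1 intf der G0 iG Gub.
apply: DeriveDef => //; rewrite -derive1E h2.
under eq_Rintegral do rewrite d1 mul1r.
have i1 : mu.-integrable setT (EFin \o (fun t => t * w t * expR (- t))).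
  apply: (le_integrable measurableT _ _ iG).
    apply/measurable_EFinP; apply: measurable_funM; first exact: measurable_funM.
    exact: measurable_expN.
  move=> t _; have := Gub 1 t I1 I; rewrite d1 mul1r normrN /= lee_fin => h.
  by rewrite (le_trans h)// ler_norm.
rewrite -mulN1r -RintegralZl//.
by apply: eq_Rintegral => t _; rewrite mulN1r.
Qed.

(** The derivative at [a = 1] of the real part of [a ^ (x + i y) (c + i s)]. *)
Lemma derive_powR_polar (x y c s : R) :
  is_derive (1 : R) 1 (fun a : R => a `^ x * (cos (y * ln a) * c - sin (y * ln a) * s))
    (x * c - y * s).
Proof.
have d1 := is_derive1_powR x (@ltr01 R).
have d2 := is_derive1_ln (@ltr01 R).
have dc : is_derive (1 : R) 1 (fun a : R => cos (y * ln a)) 0.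
  apply: is_derive_eq; rewrite ln1 mulr0 sin0.
  by rewrite /GRing.scale /=; ring.
have ds : is_derive (1 : R) 1 (fun a : R => sin (y * ln a)) y.
  apply: is_derive_eq; rewrite ln1 mulr0 cos0.
  by rewrite /GRing.scale /= invr1; ring.
apply: is_derive_eq; rewrite /GRing.scale /= ln1 !mulr0 cos0 sin0 !powR1 /=.
by ring.
Qed.

(** Both sides are minus the derivative at [a = 1] of
    [a ^ (- z) Gamma z = int_0^oo t ^ (z - 1) e ^ (- a t) dt]: the right one by
    differentiating the power, the left one under the integral sign. *)
Lemma cGamma_add1 z : 0 < Re z -> cGamma (z + 1) = z * cGamma z.
Proof.
move=> z0; have z10 : 0 < Re (z + 1) by rewrite ReD /= addr_gt0.
have [mr mi] := cmeasurable_mellin z.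
have near1 (F : R -> R) G l : (forall a, 0 < a -> F a = G a) ->
    is_derive (1 : R) 1 F l -> is_derive (1 : R) 1 G l.
  move=> FG; apply: near_eq_is_derive.
  by near=> a; rewrite FG//; near: a; exact: lt_nbhsr.
have tm (t : R) : t%:C * mellin z t = mellin (z + 1) t.
  have [t0|t0] := ltP 0 t; first by rewrite mellinD// rpowc1.
  by rewrite /mellin ltNge t0 mulr0.
set g := cGamma z.
have Fr a : 0 < a -> Rintegral mu setT (fun t => Re (mellin z t) * expR (- (a * t))) =
    a `^ (- Re z) * (cos (- Im z * ln a) * Re g - sin (- Im z * ln a) * Im g).
  move=> a0; have [_ /(congr1 Re) /=] := cintegral_mellin_exp a0 z0.
  under eq_Rintegral do rewrite ReM /= mulr0 subr0.
  by move=> ->; rewrite ReM /rpowc ReM ImM ReN ImN /=; ring.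
have Fi a : 0 < a -> Rintegral mu setT (fun t => Im (mellin z t) * expR (- (a * t))) =
    a `^ (- Re z) * (cos (- Im z * ln a) * Im g - sin (- Im z * ln a) * (- Re g)).
  move=> a0; have [_ /(congr1 Im) /=] := cintegral_mellin_exp a0 z0.
  under eq_Rintegral do rewrite ImM /= mulr0 add0r.
  by move=> ->; rewrite ImM /rpowc ReM ImM ReN ImN /=; ring.
have rle t : `|Re (mellin z t)| <= mellinr (Re z) t.
  by rewrite -normc_mellin Re_le_normc.
have ile t : `|Im (mellin z t)| <= mellinr (Re z) t.
  by rewrite -normc_mellin Im_le_normc.
have dr := near1 _ _ _ Fr (derive_laplace z0 mr rle).
have di := near1 _ _ _ Fi (derive_laplace z0 mi ile).
apply: complex_eqP; rewrite cGammaE ?z10// ?ReM ?ImM.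
- have [_ e1] := derive_powR_polar (- Re z) (- Im z) (Re g) (Im g).
  have [_] := dr; rewrite e1 => /(congr1 -%R); rewrite opprK => e.
  transitivity (Rintegral mu setT (fun t => t * Re (mellin z t) * expR (- t))).
    apply: eq_Rintegral => t _; rewrite /gammac -tm !ReM /=; ring.
  by rewrite -e; ring.
- have [_ e1] := derive_powR_polar (- Re z) (- Im z) (Im g) (- Re g).
  have [_] := di; rewrite e1 => /(congr1 -%R); rewrite opprK => e.
  transitivity (Rintegral mu setT (fun t => t * Im (mellin z t) * expR (- t))).
    apply: eq_Rintegral => t _; rewrite /gammac -tm !ImM !ReM /=; ring.
  by rewrite -e; ring.
Unshelve. all: by end_near. Qed.

End GammaFunctional.

(** * Lower bounds for Gamma on vertical lines *)

Section ElementaryInequalities.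
Context {R : realType}.

Lemma cos_ge (x : R) : 1 - x ^+ 2 / 2 <= cos x.
Proof.
have sin_le (u : R) : 0 <= u -> sin u <= u.
  move=> u0; rewrite -subr_ge0.
  have [->|un0] := eqVneq u 0; first by rewrite sin0 subrr.
  have u1 : 0 < u by rewrite lt0r un0.
  have d (v : R) : is_derive v 1 (fun v : R => v - sin v) (1 - cos v).
    exact: is_deriveB.
  have := @MVT _ (fun v : R => v - sin v) (fun v => 1 - cos v) 0 u u1 (fun v _ => d v).
  case.
    by apply: derivable_within_continuous => v _; have [] := d v.
  move=> c _; rewrite sin0 !subr0 => ->.
  by rewrite mulr_ge0 // subr_ge0 cos_le1.
have sin_sq (u : R) : sin u ^+ 2 <= u ^+ 2.
  wlog u0 : u / 0 <= u => [h|].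
    have [/h//|/ltW] := leP 0 u; rewrite -oppr_ge0 => /h.
    by rewrite sinN !sqrrN.
  rewrite -real_normK ?num_real// lerXn2r ?nnegrE// ler_norml sin_le// andbT.
  have [u1|u1] := leP u 1.
    apply: (@le_trans _ _ 0); first by rewrite oppr_le0.
    apply: sin_ge0_pi; rewrite u0 /= (le_trans u1)//.
    by rewrite (le_trans _ (pi_ge2 R))// ler1n.
  by apply: le_trans (sin_geN1 u); rewrite lerN2 ltW.
have -> : cos x = 1 - 2 * sin (x / 2) ^+ 2.
  have {1}-> : x = x / 2 + x / 2 by lra.
  by rewrite cosD -!expr2 cos2sin2; ring.
have := sin_sq (x / 2); rewrite expr_div_n => h; lra.
Qed.

(** With [r = e ^ (2 v)], the right side is [4 (e ^ v - e ^ (- v)) ^ 2], and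
    [|e ^ v - e ^ (- v)| >= |v|].  The right side integrates explicitly against
    the Gamma density. *)
Lemma ln_sqr_le (r : R) : 0 < r -> ln r ^+ 2 <= 4 * (r - 2 + r^-1).
Proof.
move=> r0; pose v := ln r / 2; pose e := expR v.
have e0 : 0 < e by exact: expR_gt0.
have rE : r = e ^+ 2.
  by rewrite /e -expRM_natl /v mulrC divfK ?lnK ?posrE.
have eV : e^-1 = expR (- v) by rewrite expRN.
have -> : ln r ^+ 2 = 4 * v ^+ 2 by rewrite /v; field.
rewrite ler_pM2l//.
have -> : r - 2 + r^-1 = (e - e^-1) ^+ 2.
  by rewrite rE; field; rewrite gt_eqF.
have h1 := expR_ge1Dx v; have h2 := expR_ge1Dx (- v).
rewrite -/e in h1; rewrite -eV in h2.
have ei0 : 0 < e^-1 by rewrite invr_gt0.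
have [v0|v0] := leP 0 v.
  have e1 : e^-1 <= 1 by rewrite eV expR_le1 oppr_le0.
  by rewrite lerXn2r ?nnegrE//; lra.
have e1 : e <= 1 by rewrite expR_le1 ltW.
rewrite -sqrrN -[leRHS]sqrrN lerXn2r ?nnegrE//; lra.
Qed.

End ElementaryInequalities.

Section GammaBounds.
Context {R : realType}.
Local Notation mu := (@lebesgue_measure R).
Implicit Types (z : R[i]) (x y : R).

Lemma rGamma_gt0 x : 0 < x -> 0 < rGamma x.
Proof.
move=> x0; apply: (Rintegral_gt0 (@ltr01 R)).
- exact: integrable_gammar.
- exact: gammar_ge0.
- by move=> t /andP[t0 _]; rewrite /gammar /mellinr t0 mulr_gt0 ?powR_gt0 ?expR_gt0.
Qed.

Lemma rGamma_add1 x : 0 < x -> rGamma (x + 1) = x * rGamma x.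
Proof.
move=> x0; apply: complexI; rewrite rmorphM /= -!cGamma_real ?addr_gt0//.
by rewrite rmorphD cGamma_add1.
Qed.

Lemma normc_cGamma_le z : 0 < Re z -> normc (cGamma z) <= rGamma (Re z).
Proof.
move=> z0; rewrite cGammaE//; apply: le_trans (normc_cintegral _) _.
  exact: cintegrable_gammac.
rewrite (_ : _ \o _ = gammar (Re z))//.
by apply/funext => t; rewrite /= normc_gammac.
Qed.

(** Concentration of the Gamma density: its mass sits near [t = T], where
    [t ^ (i y)] is close to the constant phase [T ^ (i y)].  After division by
    that phase the real part of the integrand is the density times
    [cos (y ln (t / T))], which is at least
    [1 - 2 y ^ 2 (t / T - 2 + T / t)]; the means of [t] and [1 / t] are [T] and
    [1 / (T - 1)]. *)
Lemma normc_cGamma_ge_large T y : 1 < T ->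
  rGamma T * (1 - 2 * y ^+ 2 / (T - 1)) <= normc (cGamma (T +i* y)).
Proof.
move=> T1; have T0 : 0 < T by lra.
have T10 : 0 < T - 1 by lra.
pose z := T +i* y.
pose w := rpowc T ((- y) *i).
have nw : normc w = 1 by rewrite normc_rpowc powRr0.
have gi : cintegrable mu setT (gammac z) by exact: cintegrable_gammac.
apply: (@le_trans _ _ (Re (w * cGamma z))); last first.
  apply: le_trans (ler_norm _) _; apply: le_trans (Re_le_normc _) _.
  by rewrite ComplexField.Normc.normcM nw mul1r.
rewrite cGammaE// -cintegralZ//=.
have iw := cintegrableZ measurableT w gi.
(* the lower bound of the integrand, as a combination of Gamma densities *)
pose c1 := 1 + 4 * y ^+ 2; pose c2 := - (2 * y ^+ 2 / T); pose c3 := - (2 * y ^+ 2 * T).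
pose h t := c1 * gammar T t + (c2 * gammar (T + 1) t + c3 * gammar (T - 1) t).
have ig u c : 0 < u -> mu.-integrable setT (EFin \o (fun t => c * gammar u t)).
  move=> u0; rewrite (_ : _ \o _ = (fun t => c%:E * (EFin \o gammar u) t)%E).
    by apply: integrableZl => //; exact: integrable_gammar.
  by apply/funext => t; rewrite /= EFinM.
have i23 : mu.-integrable setT (EFin \o (fun t => c2 * gammar (T + 1) t + c3 * gammar (T - 1) t)).
  by apply: (integrableD measurableT (ig (T + 1) c2 _) (ig (T - 1) c3 _)); lra.
have ih : mu.-integrable setT (EFin \o h).
  exact: (integrableD measurableT (ig T c1 T0) i23).
have hE : Rintegral mu setT h = rGamma T * (1 - 2 * y ^+ 2 / (T - 1)).
  have T20 : 0 < T + 1 by lra.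
  rewrite /h (RintegralD measurableT (ig T c1 T0) i23).
  rewrite (RintegralD measurableT (ig _ c2 T20) (ig _ c3 T10)).
  rewrite (RintegralZl _ measurableT (integrable_gammar T0)).
  rewrite (RintegralZl _ measurableT (integrable_gammar T10)).
  rewrite (RintegralZl _ measurableT (integrable_gammar T20)).
  rewrite -!/(rGamma _) rGamma_add1//.
  have -> : rGamma T = (T - 1) * rGamma (T - 1) by rewrite -rGamma_add1 ?subrK.
  by rewrite /c1 /c2 /c3; field; rewrite !gt_eqF.
rewrite -hE; apply: le_Rintegral => //; first exact: iw.1.
move=> t _; rewrite /h /gammar /gammac /mellin /mellinr.
case: ifPn => [t0|_]; last by rewrite !mul0r !mulr0 !addr0.
have -> : t `^ (T + 1 - 1) = t * t `^ (T - 1).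
  by rewrite mulr_powRB1 ?ltW//; congr (_ `^ _); ring.
have -> : t `^ (T - 1 - 1) = t^-1 * t `^ (T - 1).
  rewrite -[t `^ (T - 1)]mulr_powRB1 ?(ltW t0)// mulrA mulVf ?mul1r ?gt_eqF//.
have -> : Re (w * (rpowc t (z - 1) * (expR (- t))%:C)) =
   t `^ (T - 1) * expR (- t) * cos (y * (ln t - ln T)).
  rewrite [y * _]mulrBr cosB /w /rpowc !(ReM, ImM) /= powRr0 !mulNr cosN sinN.
  by rewrite subr0; ring.
set g := t `^ (T - 1) * expR (- t).
have g0 : 0 <= g by rewrite mulr_ge0 ?powR_ge0 ?expR_ge0.
have := cos_ge (y * (ln t - ln T)).
have := ln_sqr_le (divr_gt0 t0 T0); rewrite ln_div ?posrE// invf_div => hl.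
have : y ^+ 2 * (ln t - ln T) ^+ 2 <= y ^+ 2 * (4 * (t / T - 2 + T / t)).
  by rewrite ler_wpM2l ?sqr_ge0.
rewrite exprMn => h1 h2.
have h3 : 1 - y ^+ 2 * (4 * (t / T - 2 + T / t)) / 2 <= cos (y * (ln t - ln T)) by lra.
rewrite [leLHS](_ : _ = g * (1 - y ^+ 2 * (4 * (t / T - 2 + T / t)) / 2)).
  exact: ler_wpM2l.
by rewrite /g /c1 /c2 /c3; field; rewrite !gt_eqF.
Qed.

Lemma normc_cGamma_ge_half z : 1 + 4 * Im z ^+ 2 < Re z ->
  rGamma (Re z) / 2 <= normc (cGamma z).
Proof.
move=> h; have y0 := sqr_ge0 (Im z).
have T1 : 1 < Re z by lra.
have T0 : 0 < Re z by lra.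
have := @normc_cGamma_ge_large (Re z) (Im z) T1.
have -> : Re z +i* Im z = z by case: (z).
apply: le_trans; rewrite ler_pM2l ?rGamma_gt0//.
have : 2 * Im z ^+ 2 / (Re z - 1) <= 2^-1; last lra.
by rewrite ler_pdivrMr; lra.
Qed.

(** By the functional equation a zero at [z] would propagate to all [z + n],
    against the lower bound for large real part. *)
Lemma cGamma_neq0 z : 0 < Re z -> cGamma z != 0.
Proof.
move=> z0; pose n := (Num.truncn (1 + 4 * Im z ^+ 2)).+1.
have zn k : z + k%:R = (Re z + k%:R) +i* Im z.
  rewrite -(rmorph_nat (real_complex R)).
  by apply: complex_eqP; rewrite ?ReD ?ImD //= addr0.
have nz : cGamma (z + n%:R) != 0.
  have h : 1 + 4 * Im z ^+ 2 < Re z + n%:R.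
    apply: lt_le_trans (truncnS_gt _) _; rewrite -/n; lra.
  have y0 := sqr_ge0 (Im z).
  rewrite -normc_eq0 gt_eqF//.
  have := @normc_cGamma_ge_half (z + n%:R); rewrite zn /= => /(_ h).
  by apply: lt_le_trans; rewrite divr_gt0 ?rGamma_gt0//; lra.
elim: (n) nz => [|k IH]; first by rewrite addr0.
rewrite -natr1 addrA cGamma_add1 ?mulf_eq0 ?negb_or; last first.
  by rewrite zn /= ltr_wpDr.
by move=> /andP[_ /IH].
Qed.

(** The lower bound covers all but finitely many terms; for the others the ratio
    is finite because Gamma does not vanish. *)
Lemma normc_cGamma_ge_progression (g : R[i]) (a : R) : 0 < Re g -> 0 < a ->
  exists K : R, 0 < K /\ forall m : nat,
    rGamma (Re g + a * m%:R) <= K * normc (cGamma (g + (a * m%:R)%:C)).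
Proof.
move=> g0 a0; pose M := (Num.truncn ((1 + 4 * Im g ^+ 2) / a)).+1.
pose r (m : nat) := rGamma (Re g + a * m%:R) / normc (cGamma (g + (a * m%:R)%:C)).
have re0 (m : nat) : 0 < Re g + a * m%:R by rewrite ltr_wpDr// mulr_ge0// ltW.
have n0 (m : nat) : 0 < normc (cGamma (g + (a * m%:R)%:C)).
  by rewrite lt0r normc_ge0 andbT normc_eq0 cGamma_neq0// ReD; exact: re0.
have r0 m : 0 <= r m by rewrite divr_ge0 ?normc_ge0 ?ltW ?rGamma_gt0.
have s0 : 0 <= \sum_(m < M) r m by apply: sumr_ge0.
(* 2 from the lower bound, the sum for the finitely many exceptions *)
exists (2 + \sum_(m < M) r m); split=> [|m]; first lra.
rewrite -ler_pdivrMr// -/(r m).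
have [mM|Mm] := ltnP m M.
  by rewrite (bigD1 (Ordinal mM))//= addrCA lerDl addr_ge0// sumr_ge0.
apply: (@le_trans _ _ 2); last by rewrite lerDl.
rewrite /r ler_pdivrMr//.
have h : 1 + 4 * Im g ^+ 2 < Re g + a * m%:R.
  have : (1 + 4 * Im g ^+ 2) / a < m%:R.
    by apply: lt_le_trans (truncnS_gt _) _; rewrite ler_nat.
  by rewrite ltr_pdivrMr// mulrC => h; lra.
have := @normc_cGamma_ge_half (g + (a * m%:R)%:C).
by rewrite ReD ImD /= addr0 => /(_ h); lra.
Qed.

End GammaBounds.

(** * The Beta integral *)

Section Beta.
Context {R : realType}.
Local Notation mu := (@lebesgue_measure R).
Implicit Types (p c : R[i]).

Definition betac p c (u : R) : R[i] := mellin p u * mellin c (1 - u).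
Definition betar (x y u : R) : R := mellinr x u * mellinr y (1 - u).

Lemma normc_betac p c u : normc (betac p c u) = betar (Re p) (Re c) u.
Proof. by rewrite /betac ComplexField.Normc.normcM !normc_mellin. Qed.

Lemma betac_real x y u : betac x%:C y%:C u = (betar x y u)%:C.
Proof. by rewrite /betac !mellin_real -rmorphM. Qed.

Lemma betar_ge0 x y u : 0 <= betar x y u.
Proof. by rewrite mulr_ge0 ?mellinr_ge0. Qed.

(** Fubini for [gamma_p(s) gamma_c(w - s)] on the plane: integrating in [w] first
    gives [Gamma p * Gamma c]; integrating in [s] first and substituting
    [s = w u] gives [Gamma (p + c)] times the Beta integral.  Integrability of
    the Beta density needs no estimate of its own: by Fubini the slice at almost
    every [w] is integrable, and the slice at one [w > 0] is a rescaled multiple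
    of that density. *)
Lemma beta_gamma p c : 0 < Re p -> 0 < Re c ->
  cintegrable mu setT (betac p c) /\
  cGamma p * cGamma c = cGamma (p + c) * cintegral mu setT (betac p c).
Proof.
move=> p0 c0.
pose F (q : measurableTypeR R * measurableTypeR R) := gammac p q.1 * gammac c (q.2 - q.1).
have ip := cintegrable_gammac p0; have ic := cintegrable_gammac c0.
have normcF s w : normc (F (s, w)) =
    gammar (Re p) s * gammar (Re c) (1 * w + - s).
  by rewrite /F /= ComplexField.Normc.normcM !normc_gammac mul1r.
have mF : cmeasurable setT F.
  apply: cmeasurableM.
    exact: (cmeasurable_comp (cmeasurable_gammac p) measurable_fst).
  apply: (cmeasurable_comp (cmeasurable_gammac c)).
  by apply: measurable_funB; [exact: measurable_snd|exact: measurable_fst].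
have iF : cintegrable (mu \x mu)%E setT F.
  apply: cintegrable_tonelli => //.
  rewrite (_ : (\int[mu]_s _)%E =
      (\int[mu]_s ((rGamma (Re c))%:E * (EFin \o gammar (Re p)) s))%E).
    have := integrableZl measurableT (rGamma (Re c)) (integrable_gammar p0).
    by move=> /(integrable_fin_num measurableT)/fin_numPlt/andP[].
  apply: eq_integral => s _.
  under eq_integral do rewrite normcF EFinM.
  have ig := integrable_affine (- s) (@ltr01 R) (integrable_gammar c0).
  rewrite (integralZl measurableT ig) muleC; congr (_ * _)%E.
  rewrite -[LHS]fineK ?integrable_fin_num//; congr EFin.
  rewrite -[LHS]/(Rintegral mu setT (fun w => gammar (Re c) (1 * w + - s))).
  by rewrite Rintegral_affine ?invr1 ?mul1r//; exact: integrable_gammar.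
pose K (w : R) := rpowc w (p + c - 2) * (expR (- w))%:C.
have FE (w : R) : 0 < w -> forall u, F (w * u + 0, w) = K w * betac p c u.
  move=> w0 u.
  rewrite /F /= addr0 /gammac (_ : w - w * u = w * (1 - u)); last by ring.
  rewrite !mellinM// /betac /K.
  have -> : rpowc w (p + c - 2) = rpowc w (p - 1) * rpowc w (c - 1).
    by rewrite -rpowcD//; congr rpowc; ring.
  have -> : expR (- w) = expR (- (w * u)) * expR (- (w * (1 - u))).
    by rewrite -expRD; congr expR; ring.
  by rewrite rmorphM /=; ring.
have iB : cintegrable mu setT (betac p c).
  apply/cintegrableP => //; split.
    apply: cmeasurableM; first exact: cmeasurable_mellin.
    apply: (cmeasurable_comp (cmeasurable_mellin c)).
    by apply: measurable_funB.
  have [_ nF] := (cintegrableP _ measurableT F).1 iF.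
  have [w [/andP[w0 _] iw]] := ae_exists (@ltr01 R) (ae_integrable2 nF).
  have := integrable_affine 0 w0 iw.
  move=> /(integrableZl measurableT (normc (K w))^-1).
  apply: eq_integrable => // u _ /=.
  have K0 : normc (K w) != 0.
    rewrite ComplexField.Normc.normcM normc_rpowc normc_real mulf_neq0//.
      by rewrite gt_eqF// powR_gt0.
    by rewrite normr_eq0 gt_eqF// expR_gt0.
  by rewrite FE// ComplexField.Normc.normcM -EFinM mulKf.
split=> //.
have e1 := cfubini1 iF; have e2 := cfubini2 iF.
rewrite (_ : cintegral mu _ _ = cGamma p * cGamma c) in e1; last first.
  rewrite mulrC (cGammaE p0) -cintegralZ//; apply: eq_cintegral => s _.
  have -> : (fun w => F (s, w)) = (fun w => gammac p s * gammac c (1 * w + - s)).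
    by apply/funext => w; rewrite mul1r.
  rewrite cintegralZ//; last exact: cintegrable_affine.
  by rewrite cintegral_affine// invr1 mul1r -cGammaE// mulrC.
rewrite e1 -e2.
have pc0 : 0 < Re (p + c) by rewrite ReD addr_gt0.
rewrite mulrC cGammaE// -cintegralZ//; last exact: cintegrable_gammac.
apply: eq_cintegral => w _.
have [w0|w0] := ltP 0 w.
  have wV0 : 0 < w^-1 by rewrite invr_gt0.
  have -> : (fun s => F (s, w)) = (fun s => K w * betac p c (w^-1 * s + 0)).
    by apply/funext => s; rewrite -FE// !addr0 mulVKf// gt_eqF.
  rewrite cintegralZ//; last exact: cintegrable_affine.
  rewrite cintegral_affine// invrK mulrA mulrC; congr (_ * _).
  rewrite /gammac /mellin w0 /K mulrAC; congr (_ * _).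
  by rewrite -(rpowc1 w0) -rpowcD//; congr rpowc; ring.
have -> : (fun s => F (s, w)) = (fun=> 0).
  apply/funext => s; rewrite /F /= /gammac /mellin.
  case: ifPn => [s0|_]; last by rewrite !mul0r.
  by rewrite ifF ?mul0r ?mulr0//; apply/negbTE; rewrite -leNgt; lra.
by rewrite cintegral0// /gammac /mellin ltNge w0 mul0r mulr0.
Qed.

Lemma cbeta_gamma p c : 0 < Re p -> 0 < Re c ->
  cintegral mu setT (betac p c) = cGamma p * cGamma c / cGamma (p + c).
Proof.
move=> p0 c0; have [_ ->] := beta_gamma p0 c0.
by rewrite mulrAC mulfV ?mul1r// cGamma_neq0// ReD addr_gt0.
Qed.

Lemma rbeta_gamma x y : 0 < x -> 0 < y ->
  mu.-integrable setT (EFin \o betar x y) /\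
  Rintegral mu setT (betar x y) = rGamma x * rGamma y / rGamma (x + y).
Proof.
move=> x0 y0; have [[ir _] _] := @beta_gamma x%:C y%:C x0 y0.
split.
  by apply: eq_integrable ir => // t _; rewrite betac_real.
have := @cbeta_gamma x%:C y%:C x0 y0.
rewrite -rmorphD !cGamma_real ?addr_gt0// -rmorphM -fmorphV -rmorphM => /(congr1 Re).
by rewrite /= => <-; apply: eq_Rintegral => t _; rewrite betac_real.
Qed.

(** On [xi, 1] one has [u ^ t >= xi ^ t], so [1 / K] may be the mass that the
    density with [t = 0] puts there. *)
Lemma powR_le_beta x y xi : 0 < x -> 0 < y -> 0 < xi < 1 ->
  exists K : R, 0 < K /\ forall t, 0 <= t ->
    xi `^ t <= K * Rintegral mu setT (betar (x + t) y).
Proof.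
move=> x0 y0 /andP[xi0 xi1].
pose D : set (measurableTypeR R) := `]xi, 1[%classic.
pose k u := (if xi < u < 1 then betar x y u else 0).
have [ib _] := rbeta_gamma x0 y0.
have kE : k = (betar x y \_ D)%FUN.
  apply/funext => u; rewrite /k patchE; congr (if _ then _ else _).
  by apply/idP/idP; rewrite inE /D /= in_itv.
have ik : mu.-integrable setT (EFin \o k).
  have mD : measurable D by exact: measurable_itv.
  rewrite kE -restrict_EFin; apply/(integrable_mkcond _ mD).1.
  exact: (integrableS measurableT mD _ ib).
have k0 : 0 < Rintegral mu setT k.
  apply: (Rintegral_gt0 xi1 ik) => u.
    by rewrite /k; case: ifP => // _; exact: betar_ge0.
  move=> h; have /andP[h1 h2] := h; rewrite /k h /betar /mellinr.
  by rewrite (lt_trans xi0 h1) subr_gt0 h2 mulr_gt0// powR_gt0// ?subr_gt0// (lt_trans xi0).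
exists (Rintegral mu setT k)^-1; split=> [|t t0]; first by rewrite invr_gt0.
rewrite ler_pdivlMl// mulrC -RintegralZl//.
have xt0 : 0 < x + t by rewrite ltr_wpDr.
have [ibt _] := rbeta_gamma xt0 y0.
apply: le_Rintegral => //.
  rewrite (_ : _ \o _ = (fun u => (xi `^ t)%:E * (EFin \o k) u)%E).
    exact: integrableZl.
  by apply/funext => u; rewrite /= EFinM.
move=> u _; rewrite /k; case: ifP => [/andP[h1 h2]|_]; last first.
  by rewrite mulr0 betar_ge0.
have u0 := lt_trans xi0 h1.
rewrite /betar mulrA ler_wpM2r ?mellinr_ge0// /mellinr u0.
have -> : u `^ (x + t - 1) = u `^ t * u `^ (x - 1).
  by rewrite -powRD; [congr (_ `^ _); ring|rewrite (gt_eqF u0) implybT].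
by rewrite ler_wpM2r ?powR_ge0// ge0_ler_powR// ?nnegrE ltW.
Qed.

End Beta.

(** * Beta kernels and Pochhammer symbols *)

(** A pole has nonpositive real part, so here the definition takes its generic
    branch. *)
Lemma cpochE (R : realType) (z : R[i]) (l : R) :
  0 < Re z -> cpoch z l = cGamma (z + l%:C) / cGamma z.
Proof.
move=> z0; rewrite /cpoch ifF//; apply/negbTE/negP => /and3P[_ /natr_ge0].
by rewrite oppr_ge0 leNgt z0.
Qed.

Section BetaKernel.
Context {R : realType}.
Local Notation mu := (@lebesgue_measure R).
Variables (g m : R[i]) (a : R).
Hypotheses (g_gt0 : 0 < Re g) (g_lt_m : Re g < Re m) (a_gt0 : 0 < a).

Definition beta_kernel (k : nat) (u : R) : R[i] :=
  betac (g + (a * k%:R)%:C) (m - g) u.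

Definition beta_factor : R[i] := cGamma m / (cGamma g * cGamma (m - g)).

Let m_gt0 : 0 < Re m. Proof. exact: lt_trans g_lt_m. Qed.
Let mg_gt0 : 0 < Re (m - g). Proof. by rewrite ReD ReN subr_gt0. Qed.
Let ak_ge0 (k : nat) : 0 <= a * k%:R. Proof. by rewrite mulr_ge0// ltW. Qed.
Let Re_shift (z : R[i]) (k : nat) : 0 < Re z -> 0 < Re (z + (a * k%:R)%:C).
Proof. by move=> z0; rewrite ReD ltr_wpDr//; exact: ak_ge0. Qed.

Lemma beta_factor_neq0 : beta_factor != 0.
Proof.
apply: mulf_neq0; first exact: cGamma_neq0.
by rewrite invr_eq0; apply: mulf_neq0; exact: cGamma_neq0.
Qed.

Lemma cintegrable_beta_kernel k : cintegrable mu setT (beta_kernel k).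
Proof. by have [] := beta_gamma (Re_shift k g_gt0) mg_gt0. Qed.

Lemma cintegral_beta_kernel k :
  beta_factor * cpoch m (a * k%:R) * cintegral mu setT (beta_kernel k) =
  cpoch g (a * k%:R).
Proof.
rewrite !cpochE// cbeta_gamma//; last exact: Re_shift.
rewrite (_ : g + _ + (m - g) = m + (a * k%:R)%:C); last by ring.
rewrite /beta_factor.
have := cGamma_neq0 m_gt0; have := cGamma_neq0 (Re_shift k m_gt0).
have := cGamma_neq0 g_gt0; have := cGamma_neq0 mg_gt0.
move: (cGamma m) (cGamma g) (cGamma (m - g)) (cGamma (m + _)) (cGamma (g + _)).
by move=> M G N Mk Gk N0 G0 Mk0 M0; field; rewrite N0 G0 Mk0 M0.
Qed.

(** By [cintegral_beta_kernel] the right side is the modulus of an integral, and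
    the left side is the integral of the modulus.  In terms of Gamma the ratio is
    bounded because [Gamma (Re g + a k)] is at most a constant times
    [|Gamma (g + a k)|], while [|Gamma (m + a k)| <= Gamma (Re m + a k)]. *)
Lemma Rintegral_beta_kernel : exists C : R, 0 < C /\ forall k,
  normc (beta_factor * cpoch m (a * k%:R)) * Rintegral mu setT (normc \o beta_kernel k)
  <= C * normc (cpoch g (a * k%:R)).
Proof.
have [K [K0 hK]] := normc_cGamma_ge_progression g_gt0 a_gt0.
have n0 (z : R[i]) : 0 < Re z -> 0 < normc (cGamma z).
  by move=> z0; rewrite lt0r normc_ge0 andbT normc_eq0 cGamma_neq0.
exists (K * rGamma (Re (m - g)) / normc (cGamma (m - g))).
split=> [|k]; first by rewrite divr_gt0 ?mulr_gt0 ?rGamma_gt0 ?n0.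
have := hK k; have := cintegral_beta_kernel k; rewrite /beta_kernel.
have := Re_shift k m_gt0; have := Re_shift k g_gt0.
move: (a * k%:R) => t gt0 mt0 <- hKk.
rewrite [normc (_ * cintegral _ _ _)]ComplexField.Normc.normcM [leRHS]mulrCA.
apply: ler_wpM2l; first exact: normc_ge0.
rewrite cbeta_gamma// !ComplexField.Normc.normcM ComplexField.Normc.normcV.
rewrite (_ : normc \o _ = betar (Re (g + t%:C)) (Re (m - g))); last first.
  by apply/funext => u; rewrite /= normc_betac.
have [_ ->] := rbeta_gamma gt0 mg_gt0.
rewrite -ReD (_ : g + t%:C + (m - g) = m + t%:C); last by ring.
have h1 : rGamma (Re (g + t%:C)) <= K * normc (cGamma (g + t%:C)) by rewrite ReD.
have h2 := normc_cGamma_le mt0.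
have := rGamma_gt0 mt0; have := rGamma_gt0 gt0; have := rGamma_gt0 mg_gt0.
have := n0 _ mt0; have := n0 _ mg_gt0; move: h1 h2.
move: (rGamma (Re (g + t%:C))) (rGamma (Re (m - g))) (rGamma (Re (m + t%:C))).
move: (normc (cGamma (g + t%:C))) (normc (cGamma (m - g))) (normc (cGamma (m + t%:C))).
move=> u v w x y z xu wz v0 w0 y0 x0 z0.
rewrite (_ : K * y / v * (u * v / w) = (K * u) * y / w); last first.
  by field; rewrite !gt_eqF.
apply: ler_pM.
- by rewrite mulr_ge0// ltW.
- by rewrite invr_ge0 ltW.
- by rewrite ler_pM2r.
- by rewrite lef_pV2 ?posrE.
Qed.

(** [powR_le_beta] trades the power for the Beta integral, to which the
    comparison above applies. *)
Lemma cpoch_powR_le (xi : R) : 0 < xi < 1 -> exists C : R, 0 < C /\ forall k : nat,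
  normc (cpoch m (a * k%:R)) * xi `^ (a * k%:R) <= C * normc (cpoch g (a * k%:R)).
Proof.
move=> xi01; have [C [C0 hC]] := Rintegral_beta_kernel.
have [K [K0 hK]] := powR_le_beta g_gt0 mg_gt0 xi01.
have F0 : 0 < normc beta_factor by rewrite lt0r normc_ge0 andbT normc_eq0 beta_factor_neq0.
exists (K * C / normc beta_factor); split=> [|k]; first by rewrite divr_gt0// mulr_gt0.
have -> : K * C / normc beta_factor * normc (cpoch g (a * k%:R)) =
  K * (C * normc (cpoch g (a * k%:R))) / normc beta_factor by ring.
rewrite ler_pdivlMr// mulrAC -ComplexField.Normc.normcM.
have := hC k; rewrite -(ler_pM2l K0); apply: le_trans.
rewrite [leRHS]mulrCA [beta_factor * _]mulrC; apply: ler_wpM2l; first exact: normc_ge0.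
rewrite (_ : normc \o _ = betar (Re g + a * k%:R) (Re (m - g))); first exact: hK.
by apply/funext => u; rewrite /= normc_betac ReD.
Qed.

Lemma beta_kernelE (k : nat) (u : R) : 0 < u < 1 ->
  rpowc u (g - 1) * rpowc (1 - u) (m - g - 1) * (u `^ a)%:C ^+ k = beta_kernel k u.
Proof.
move=> /andP[u0 u1]; rewrite /beta_kernel /betac mellinD// rpowc_real powRrM.
rewrite powR_mulrn ?powR_ge0// rmorphXn /= /mellin u0 subr_gt0 u1.
by ring.
Qed.

Lemma beta_kernel0 (k : nat) (u : R) : ~~ (0 < u < 1) -> beta_kernel k u = 0.
Proof.
rewrite /beta_kernel /betac /mellin subr_gt0.
by case: (0 < u); case: (u < 1) => //=; rewrite ?mul0r ?mulr0.
Qed.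

End BetaKernel.

(** * Proof of the integral representation *)

Lemma ler_split_prod (R : realDomainType) (c p q I J A B e f : R) :
  0 <= c -> 0 <= p * I -> 0 <= q * J -> p * I <= A * e -> q * J <= B * f ->
  c * p * q * (I * J) <= A * B * (c * e * f).
Proof.
move=> c0 pI0 qJ0 pI qJ.
rewrite (_ : c * p * q * (I * J) = c * ((p * I) * (q * J))); last by ring.
rewrite (_ : A * B * (c * e * f) = c * ((A * e) * (B * f))); last by ring.
by apply: ler_wpM2l => //; exact: ler_pM.
Qed.

(** The part of the general term left unchanged by the transformation. *)
Definition D1_coef (R : realType) (g1 : R[i]) (a1 b1 : R)
    (d1 : R[i]) (a3 b3 : R) (d2 : R[i]) (a4 : R) (d3 : R[i]) (b4 : R)
    (x y : R[i]) (m n : nat) : R[i] :=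
  cpoch g1 (a1 * m%:R + b1 * n%:R) / cGamma (d1 + (a3 * m%:R + b3 * n%:R)%:C)
  * (x ^+ m / cGamma (d2 + (a4 * m%:R)%:C))
  * (y ^+ n / cGamma (d3 + (b4 * n%:R)%:C)).

Lemma D1_termE (R : realType) g1 a1 b1 g2 a2 g3 b2 d1 a3 b3 d2 a4 d3 b4
    (x y r s : R[i]) (m n : nat) :
  @D1_term R g1 a1 b1 g2 a2 g3 b2 d1 a3 b3 d2 a4 d3 b4 (x * r) (y * s) m n =
  D1_coef g1 a1 b1 d1 a3 b3 d2 a4 d3 b4 x y m n
    * (cpoch g2 (a2 * m%:R) * r ^+ m) * (cpoch g3 (b2 * n%:R) * s ^+ n).
Proof.
rewrite /D1_term /D1_coef !exprMn.
move: (cpoch _ _) (cpoch _ _) (cpoch _ _) (cGamma _)^-1 (cGamma _)^-1 (cGamma _)^-1.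
move=> A B C D E F; move: (x ^+ m) (r ^+ m) (y ^+ n) (s ^+ n) => G H I J.
ring.
Qed.

Theorem mainTheorem4 (R : realType)
    (g1 g2 g3 d1 d2 d3 x y mu1 mu2 : R[i])
    (a1 a2 a3 a4 b1 b2 b3 b4 : R)
    (a1_gt0 : 0 < a1) (a2_gt0 : 0 < a2) (a3_gt0 : 0 < a3) (a4_gt0 : 0 < a4)
    (b1_gt0 : 0 < b1) (b2_gt0 : 0 < b2) (b3_gt0 : 0 < b3) (b4_gt0 : 0 < b4)
    (g2_gt0 : 0 < complex.Re g2) (g2_lt_mu1 : complex.Re g2 < complex.Re mu1)
    (g3_gt0 : 0 < complex.Re g3) (g3_lt_mu2 : complex.Re g3 < complex.Re mu2)
    (xy_conv : D1_abs_conv g1 a1 b1 g2 a2 g3 b2 d1 a3 b3 d2 a4 d3 b4 x y) :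
  let lambda2 : {measure set (measurableTypeR R * measurableTypeR R) -> \bar R} :=
    (@lebesgue_measure R \x @lebesgue_measure R)%E in
  let square := `]0, 1[ `*` `]0, 1[ : set (R * R) in
  let integrand (p : R * R) : R[i] :=
    let xi := p.1 in
    let eta := p.2 in
    rpowc xi (g2 - 1) * rpowc eta (g3 - 1)
    * rpowc (1 - xi) (mu1 - g2 - 1) * rpowc (1 - eta) (mu2 - g3 - 1)
    * D1 g1 a1 b1 mu1 a2 mu2 b2 d1 a3 b3 d2 a4 d3 b4
        (x * (xi `^ a2)%:C) (y * (eta `^ b2)%:C) in
  [/\ forall xi eta : R, 0 < xi < 1 -> 0 < eta < 1 ->
        D1_abs_conv g1 a1 b1 mu1 a2 mu2 b2 d1 a3 b3 d2 a4 d3 b4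
          (x * (xi `^ a2)%:C) (y * (eta `^ b2)%:C),
      cintegrable lambda2 square integrand
    & D1 g1 a1 b1 g2 a2 g3 b2 d1 a3 b3 d2 a4 d3 b4 x y =
      cGamma mu1 * cGamma mu2
        / (cGamma g2 * cGamma g3 * cGamma (mu1 - g2) * cGamma (mu2 - g3))
      * cintegral lambda2 square integrand].
Proof.
move=> lambda2 square integrand.
pose cf := D1_coef g1 a1 b1 d1 a3 b3 d2 a4 d3 b4 x y.
pose u m n := cf m n * cpoch g2 (a2 * m%:R) * cpoch g3 (b2 * n%:R).
have uE : D1_term g1 a1 b1 g2 a2 g3 b2 d1 a3 b3 d2 a4 d3 b4 x y = u.
  apply/funext => m; apply/funext => n.
  by rewrite -[x]mulr1 -[y]mulr1 D1_termE !expr1n !mulr1.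
rewrite /D1_abs_conv uE in xy_conv.
have [S uS] := (abs_summable2P u).1 xy_conv.
have conv xi eta : 0 < xi < 1 -> 0 < eta < 1 ->
    D1_abs_conv g1 a1 b1 mu1 a2 mu2 b2 d1 a3 b3 d2 a4 d3 b4
      (x * (xi `^ a2)%:C) (y * (eta `^ b2)%:C).
  move=> hxi heta.
  have [C1 [C10 hC1]] := cpoch_powR_le g2_gt0 g2_lt_mu1 a2_gt0 hxi.
  have [C2 [C20 hC2]] := cpoch_powR_le g3_gt0 g3_lt_mu2 b2_gt0 heta.
  apply/abs_summable2P; exists (C1 * C2 * S) => N.
  apply: (@le_trans _ _ (C1 * C2 * square_sum (fun m n => normc (u m n)) N)); last first.
    by rewrite ler_pM2l ?mulr_gt0.
  rewrite -square_sumZ; apply: le_square_sum => m n.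
  rewrite D1_termE /u -/(cf m n); move: (cf m n) => co.
  rewrite !ComplexField.Normc.normcM.
  have npow (t c : R) (k : nat) : normc ((t `^ c)%:C ^+ k) = t `^ (c * k%:R).
    have -> : (t `^ c)%:C ^+ k = ((t `^ c) ^+ k)%:C by rewrite rmorphXn.
    by rewrite normc_real powRrM powR_mulrn ?ger0_norm ?exprn_ge0 ?powR_ge0.
  rewrite !npow.
  rewrite (_ : C1 * C2 * _ = normc co * (C1 * normc (cpoch g2 (a2 * m%:R)))
     * (C2 * normc (cpoch g3 (b2 * n%:R)))); last by ring.
  apply: ler_pM; [|by rewrite mulr_ge0 ?normc_ge0 ?powR_ge0| |exact: hC2].
    by rewrite !mulr_ge0 ?normc_ge0 ?powR_ge0.
  by apply: ler_wpM2l; [exact: normc_ge0|exact: hC1].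
pose k1 := beta_factor g2 mu1; pose k2 := beta_factor g3 mu2.
pose bk1 := beta_kernel g2 mu1 a2; pose bk2 := beta_kernel g3 mu2 b2.
(* chosen so that [v m n] integrates to [u m n], while inside the square the
   series of the [v m n] is [k1 * k2] times the integrand *)
pose v m n (p : measurableTypeR R * measurableTypeR R) :=
  (cf m n * (k1 * cpoch mu1 (a2 * m%:R)) * (k2 * cpoch mu2 (b2 * n%:R)))
  * (bk1 m p.1 * bk2 n p.2).
have i1 m := cintegrable_beta_kernel g2_gt0 g2_lt_mu1 a2_gt0 m.
have i2 n := cintegrable_beta_kernel g3_gt0 g3_lt_mu2 b2_gt0 n.
have iv m n : cintegrable lambda2 setT (v m n).
  by apply: cintegrableZ => //; exact: (cintegrable_prod (i1 m) (i2 n)).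
have intv m n : cintegral lambda2 setT (v m n) = u m n.
  rewrite /v cintegralZ//; last exact: (cintegrable_prod (i1 m) (i2 n)).
  rewrite (cintegral_prod (i1 m) (i2 n)) /u.
  rewrite -(cintegral_beta_kernel g2_gt0 g2_lt_mu1 a2_gt0 m).
  rewrite -(cintegral_beta_kernel g3_gt0 g3_lt_mu2 b2_gt0 n).
  rewrite -/k1 -/k2 -/bk1 -/bk2.
  move: (cintegral _ _ _) (cintegral _ _ _) (cpoch _ _) (cpoch _ _) => X Y Z W.
  ring.
have [C1 [C10 hC1]] := Rintegral_beta_kernel g2_gt0 g2_lt_mu1 a2_gt0.
have [C2 [C20 hC2]] := Rintegral_beta_kernel g3_gt0 g3_lt_mu2 b2_gt0.
have vS N : square_sum (fun m n => Rintegral lambda2 setT (normc \o v m n)) N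
    <= C1 * C2 * S.
  apply: (@le_trans _ _ (C1 * C2 * square_sum (fun m n => normc (u m n)) N)); last first.
    by rewrite ler_pM2l ?mulr_gt0.
  rewrite -square_sumZ; apply: le_square_sum => m n.
  have [_ n1] := (cintegrableP _ measurableT _).1 (i1 m).
  have [_ n2] := (cintegrableP _ measurableT _).1 (i2 n).
  have n12 : lambda2.-integrable setT
      (EFin \o (fun p => (normc \o bk1 m) p.1 * (normc \o bk2 n) p.2)).
    have [_ h] := (cintegrableP _ measurableT _).1 (cintegrable_prod (i1 m) (i2 n)).
    by apply: eq_integrable h => // p _; rewrite /= ComplexField.Normc.normcM.
  rewrite (_ : normc \o v m n = fun p =>
    (normc (cf m n) * normc (k1 * cpoch mu1 (a2 * m%:R)) * normc (k2 * cpoch mu2 (b2 * n%:R)))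
    * ((normc \o bk1 m) p.1 * (normc \o bk2 n) p.2)); last first.
    apply/funext => p; rewrite /v /= [LHS]ComplexField.Normc.normcM.
    congr (_ * _); last by rewrite ComplexField.Normc.normcM.
    by rewrite ComplexField.Normc.normcM [X in X * _ = _]ComplexField.Normc.normcM.
  rewrite RintegralZl// Rintegral_prod//; try by move=> ?; exact: normc_ge0.
  rewrite /u; move: (cf m n) => co.
  rewrite [normc (co * _ * _)]ComplexField.Normc.normcM.
  rewrite [normc (co * _)]ComplexField.Normc.normcM.
  apply: ler_split_prod (hC1 m) (hC2 n); rewrite ?mulr_ge0 ?normc_ge0//;
    by apply: Rintegral_ge0 => t _; exact: normc_ge0.
have kk0 : k1 * k2 != 0 by rewrite mulf_neq0 ?beta_factor_neq0.
have insq p : (p \in square) = (0 < p.1 < 1) && (0 < p.2 < 1).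
  apply/idP/idP => [|/andP[h1 h2]]; rewrite /square inE /= !in_itv /=; last by split.
  by move=> [-> ->].
have vE p : 0 < p.1 < 1 -> 0 < p.2 < 1 -> (fun m n => v m n p) =
  fun m n => (k1 * k2 * (rpowc p.1 (g2 - 1) * rpowc p.2 (g3 - 1)
     * rpowc (1 - p.1) (mu1 - g2 - 1) * rpowc (1 - p.2) (mu2 - g3 - 1))) *
     D1_term g1 a1 b1 mu1 a2 mu2 b2 d1 a3 b3 d2 a4 d3 b4
        (x * (p.1 `^ a2)%:C) (y * (p.2 `^ b2)%:C) m n.
  move=> h1 h2; apply/funext => m; apply/funext => n.
  rewrite D1_termE /v -/(cf m n) /bk1 /bk2 -!beta_kernelE//.
  move: (rpowc _ _) (rpowc _ _) (rpowc _ _) (rpowc _ _) (cpoch _ _) (cpoch _ _) (_ ^+ m) (_ ^+ n).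
  by move=> *; ring.
have v0 p : ~~ ((0 < p.1 < 1) && (0 < p.2 < 1)) ->
    (fun m n => v m n p) = (fun _ _ => 0).
  rewrite negb_and => h; apply/funext => m; apply/funext => n.
  by rewrite /v /bk1 /bk2; case/orP: h => h;
    rewrite (beta_kernel0 _ _ _ _ h) ?(mul0r, mulr0).
have vsum p : abs_summable2 (fun m n => v m n p).
  have [/andP[h1 h2]|h] := boolP ((0 < p.1 < 1) && (0 < p.2 < 1)).
    by rewrite vE//; apply: abs_summable2Z; exact: conv.
  by rewrite v0//; exact: abs_summable2_0.
have sumE : crestrict square (fun p => k1 * k2 * integrand p) =
    (fun p => csum2 (fun m n => v m n p)).
  apply/funext => p; rewrite crestrictE insq.
  case: ifPn => [/andP[h1 h2]|].
    by rewrite vE// csum2Z ?mulrA//; exact: conv.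
  by move=> h; rewrite v0// csum2_0.
have msq : measurable (square : set (measurableTypeR R * measurableTypeR R)).
  have mI : measurable (`]0, 1[%classic : set (measurableTypeR R)).
    exact: measurable_itv.
  exact: (measurableX mI mI).
have [iS eS] := cintegral_csum2 measurableT iv vS (fun p _ => vsum p).
rewrite -sumE in iS; rewrite -sumE in eS.
have ikk := (cintegrable_restrict lambda2 msq _).2 iS.
have ii : cintegrable lambda2 square integrand.
  apply: (eq_cintegrable msq _ (cintegrableZ msq (k1 * k2)^-1 ikk)) => p _.
  by rewrite mulKf.
split=> //.
rewrite /D1 uE; transitivity (csum2 (fun m n => cintegral lambda2 setT (v m n))).
  by congr csum2; apply/funext => m; apply/funext => n; rewrite intv.
rewrite -eS -cintegral_restrict// cintegralZ//; congr (_ * _).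
by rewrite /k1 /k2 /beta_factor !invfM; move: (_^-1) (_^-1) (_^-1) (_^-1); intros; ring.
Qed.
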